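(* For any subsets $S_1\subseteq[n-1]$, $S_2\subseteq[n]$ and any bipartition $(\mu^1,\mu^2)$ of $n$, the multiplicity of the irreducible $B_n$-representation corresponding to $(\mu^1,\mu^2)$ in $R^B_{\lambda_{S_1,S_2}}$ equals $$|\{T\in SYT(\mu^1,\mu^2)\mid {\it Des}(T)=S_1,\ {\it Neg}(T)=S_2\}|.$$
   Context: $P_n=\mathbf{Q}[x_1,\dots,x_n]$; $B_n$ (signed permutations of $[-n,n]\setminus\{0\}$) acts by $\sigma(x_i)=\mathrm{sign}(\sigma(i))x_{|\sigma(i)|}$; $I^B_n$ is the ideal generated by polynomials without constant term symmetric in $x_1^2,\dots,x_n^2$; $\psi^B:P_n\to P_n/I^B_n$ the projection. For a monomial $m=\prod x_i^{p_i}$, $\lambda(m)$ is $(p_1,\dots,p_n)$ sorted weakly decreasingly. For a partition $\lambda$ with at most $n$ parts, $P^{\trianglelefteq}_\lambda$ (resp. $P^{\triangleleft}_\lambda$) is the span of monomials with $\lambda(m)$ dominated (resp. strictly dominated) by $\lambda$, and $R^B_\lambda:=\psi^B(P^{\trianglelefteq}_\lambda)/\psi^B(P^{\triangleleft}_\lambda)$. $\lambda_{S_1,S_2}\in\mathbf N^n$ has $i$-th entry $2|\{j\in S_1:j\ge i\}|+\mathbf 1_{S_2}(i)$. Irreducible $B_n$-characters $\chi^{\lambda^1,\lambda^2}$ are indexed by bipartitions via the Frobenius formula $\prod_i(p_{\mu^1_i}(x)+p_{\mu^1_i}(y))\prod_j(p_{\mu^2_j}(x)-p_{\mu^2_j}(y))=\sum_{(\lambda^1,\lambda^2)}\chi^{\lambda^1,\lambda^2}_{\mu^1,\mu^2}s_{\lambda^1}(x)s_{\lambda^2}(y)$,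 where $(\mu^1,\mu^2)$ is the signed cycle type (lengths of positive cycles, lengths of negative cycles). A standard Young tableau $T=(T^1,T^2)$ of shape $(\mu^1,\mu^2)$ is a filling of the disjoint diagrams of $\mu^1$ and $\mu^2$ with $1,\dots,n$, each used once, increasing along rows and columns of each diagram; the diagram of $\mu^2$ is placed southwest of (strictly below) that of $\mu^1$. ${\it Des}(T)$ is the set of $i$ with $i+1$ in a row strictly below that of $i$ (rows of $\mu^2$ counting as below all rows of $\mu^1$), and ${\it Neg}(T)$ is the set of entries of $T^2$. *)

(* Defs.v *)
From HB Require Import structures.
From mathcomp Require Import all_boot all_fingroup all_algebra all_solvable.
From mathcomp Require Import all_field all_character.
From mathcomp Require Import boolp.
From mathcomp Require Import mpoly.

Set Implicit Arguments.
Unset Strict Implicit.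
Unset Printing Implicit Defensive.

Import GRing.Theory.
Local Open Scope ring_scope.

(** [affords act U W rG]: in some basis [e] of [U / W], the matrix of the
    action of [g] on [U / W] is [rG g].  The coordinates of [g e_i] are the
    [i]-th row of [rG g], and products in [gT] are composed from left to right
    (as for permutations), which is the row-vector convention of
    [mx_representation]. *)

Section Subquotient.

Variables (F : fieldType) (V : lmodType F) (gT : finGroupType) (G : {group gT}).
Variables (act : gT -> V -> V) (U W : V -> Prop).

Definition affords d (rG : mx_representation F G d) : Prop :=
  exists e : 'I_d -> V,
    [/\ forall i, U (e i),
        forall u, U u -> exists! c : 'rV[F]_d, W (u - \sum_i c 0 i *: e i)
      & forall g i, g \in G -> W (act g (e i) - \sum_j rG g i j *: e j)].

Hypothesis W0 : W 0.
Hypothesis WD : forall u v, W u -> W v -> W (u + v).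
Hypothesis WZ : forall a u, W u -> W (a *: u).
Hypothesis actD : forall g u v, g \in G -> act g (u + v) = act g u + act g v.
Hypothesis actZ : forall g a u, g \in G -> act g (a *: u) = a *: act g u.
Hypothesis act1 : forall u, act 1%g u = u.
Hypothesis actM : {in G &, forall g h u, act (g * h)%g u = act h (act g u)}.
Hypothesis actU : forall g u, g \in G -> U u -> U (act g u).
Hypothesis actW : forall g u, g \in G -> W u -> W (act g u).
Hypothesis fingenU : exists k (f : 'I_k -> V), (forall i, U (f i)) /\
  forall u, U u -> exists c : 'I_k -> F, u = \sum_i c i *: f i.

Lemma affords_exists :
  exists d, exists rG : mx_representation F G d, affords rG.
Proof.
have WN u : W u -> W (- u) by rewrite -scaleN1r; apply: WZ.
have WB u v : W u -> W v -> W (u - v) by move=> Wu /WN; apply: WD.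
pose spans k (f : 'I_k -> V) := (forall i, U (f i)) /\
  forall u, U u -> exists c : 'I_k -> F, W (u - \sum_i c i *: f i).
have exd : exists k, `[< exists f : 'I_k -> V, spans k f >].
  case: fingenU => k [f [Uf gf]]; exists k; apply/asboolP; exists f; split=> //.
  by move=> u /gf[c ->]; exists c; rewrite subrr.
case: (ex_minnP exd) => d /asboolP[e [Ue ge]] dmin.
have free_e (a : 'I_d -> F) : W (\sum_i a i *: e i) -> forall i, a i = 0.
  case: d e Ue ge dmin a => [|d] e Ue ge dmin a Wa i; first by case: i.
  apply/eqP/negPn/negP=> ai0.
  suff /asboolP/dmin: exists f : 'I_d -> V, spans d f by rewrite ltnn.
  exists (fun j => e (lift i j)); split=> [j | u Uu]; first exact: Ue.
  have [c Wc] := ge u Uu.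
  exists (fun j => c (lift i j) - c i / a i * a (lift i j)).
  have := WD Wc (WZ (c i / a i) Wa); rewrite !(bigD1_ord i) //= scalerDr.
  rewrite scalerA mulfVK // opprD !addrA.
  rewrite [u - _ - _ + _]addrAC subrK scaler_sumr -addrA.
  congr W; congr (_ + _); rewrite addrC -sumrB -sumrN; apply: eq_bigr => j _.
  by rewrite scalerBl scalerA opprB.
have uniq_e u : U u -> exists! c : 'rV[F]_d, W (u - \sum_i c 0 i *: e i).
  move=> Uu; have [c Wc] := ge u Uu; exists (\row_i c i); split.
    by under eq_bigr do rewrite mxE.
  move=> c' Wc'; apply/rowP=> i; rewrite mxE; apply/eqP; rewrite -subr_eq0.
  apply/eqP; apply: (free_e (fun i => c i - c' 0 i)).
  have := WB _ _ Wc' Wc; congr W; rewrite opprB addrC addrA addrNK.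
  by rewrite -sumrB; apply: eq_bigr => j _; rewrite scalerBl.
have /choice[M0 M0P] : forall gi : gT * 'I_d, exists c : 'rV[F]_d,
    gi.1 \in G -> W (act gi.1 (e gi.2) - \sum_j c 0 j *: e j).
  case=> g i /=; have [Gg|nGg] := boolP (g \in G); last by exists 0.
  by have [c [Wc _]] := uniq_e _ (actU Gg (Ue i)); exists c.
pose M g := \matrix_(i, j) M0 (g, i) 0 j.
have MP g i : g \in G -> W (act g (e i) - \sum_j M g i j *: e j).
  by move=> Gg; under eq_bigr do rewrite mxE; exact: (M0P (g, i)).
have actN g u : g \in G -> act g (- u) = - act g u.
  by move=> Gg; rewrite -scaleN1r actZ // scaleN1r.
have act_sum g (c : 'I_d -> F) : g \in G ->
    act g (\sum_i c i *: e i) = \sum_i c i *: act g (e i).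
  move=> Gg; have act0 : act g 0 = 0 by have := actZ 0 0 Gg; rewrite !scale0r.
  by rewrite (big_morph (act g) (fun u v => actD u v Gg) act0); apply: eq_bigr => i _;
    apply: actZ.
suff rM : mx_repr G M by exists d, (MxRepresentation rM), e.
split.
  apply/matrixP=> i j; apply/eqP; rewrite -subr_eq0; apply/eqP.
  apply: (free_e (fun j => M 1%g i j - (1%:M : 'M_d) i j)).
  have := WN _ (MP 1%g i (group1 G)); congr W; rewrite act1 opprB.
  under [RHS]eq_bigr do rewrite scalerBl; rewrite sumrB; congr (_ - _).
  rewrite (bigD1 i) //= mxE eqxx scale1r big1 ?addr0 // => k ki.
  by rewrite mxE eq_sym (negPf ki) scale0r.
move=> g h Gg Gh; apply/matrixP=> i j; apply/eqP; rewrite -subr_eq0; apply/eqP.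
apply: (free_e (fun j => M (g * h)%g i j - (M g *m M h) i j)).
have W1 := WN _ (MP _ i (groupM Gg Gh)).
have W2 := actW Gh (MP g i Gg).
have W3 : W (\sum_k M g i k *: (act h (e k) - \sum_j M h k j *: e j)).
  by elim/big_ind: _ => // k _; apply/WZ/MP.
have := WD (WD W1 W2) W3; congr W.
rewrite actD // actN // act_sum // actM // opprB addrA addrNK.
under [RHS]eq_bigr do rewrite scalerBl; rewrite sumrB -addrA; congr (_ + _).
under [X in - _ + X]eq_bigr do rewrite scalerBr; rewrite sumrB addrA addNr add0r.
congr (- _); under [RHS]eq_bigr do rewrite mxE scaler_suml.
rewrite exchange_big /=; apply: eq_bigr => k _; rewrite scaler_sumr.
by apply: eq_bigr => l _; rewrite scalerA.
Qed.

End Subquotient.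

(** [(i, false)] and [(i, true)] stand for the elements [i + 1] and [-(i + 1)]
    of [[-n, n] \ {0}]. *)

Definition opp_signed n (z : 'I_n * bool) : 'I_n * bool := (z.1, ~~ z.2).

Definition Bset n : {set {perm 'I_n * bool}} :=
  [set s : {perm _} | [forall z, s (opp_signed z) == opp_signed (s z)]].

Lemma BsetP n (s : {perm 'I_n * bool}) :
  reflect (forall z, s (opp_signed z) = opp_signed (s z)) (s \in Bset n).
Proof. by rewrite inE; apply: (iffP forallP) => sP z; apply/eqP. Qed.

Lemma Bset_group n : group_set (Bset n).
Proof.
apply/group_setP; split=> [|s t /BsetP sP /BsetP tP].
  by apply/BsetP=> z; rewrite !perm1.
by apply/BsetP=> z; rewrite !permM sP tP.
Qed.

Canonical B n : {group {perm 'I_n * bool}} := Group (Bset_group n).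

(* [sabs s i] is [|s(i)|] and [sneg s i] tells whether [s(i)] is negative. *)
Definition sabs n (s : {perm 'I_n * bool}) (i : 'I_n) : 'I_n := (s (i, false)).1.
Definition sneg n (s : {perm 'I_n * bool}) (i : 'I_n) : bool := (s (i, false)).2.

(* A cycle of [s] is an orbit of [|s|]; it is negative if its product of signs
   is [-1]. *)
Definition cycles n (s : {perm 'I_n * bool}) : {set {set 'I_n}} :=
  [set [set j | fconnect (sabs s) i j] | i : 'I_n].
Definition neg_cycle n (s : {perm 'I_n * bool}) (C : {set 'I_n}) : bool :=
  odd #|[set i in C | sneg s i]|.

(* The signed cycle type of [s], with parts in no particular order. *)
Definition pos_lengths n (s : {perm 'I_n * bool}) : seq nat :=
  [seq #|C| | C : {set _} <- enum [set C in cycles s | ~~ neg_cycle s C]].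
Definition neg_lengths n (s : {perm 'I_n * bool}) : seq nat :=
  [seq #|C| | C : {set _} <- enum [set C in cycles s | neg_cycle s C]].

(** A partition of an integer at most [n] is given by its [n] first parts
    (the others vanish), all of which are at most [n]. *)

Definition shape n := {ffun 'I_n -> 'I_n.+1}.

Definition is_part n (la : shape n) : bool :=
  [forall i : 'I_n, forall j : 'I_n, (i <= j)%N ==> (la j <= la i)%N].

Definition is_bipart n (mu : shape n * shape n) : bool :=
  [&& is_part mu.1, is_part mu.2 & \sum_i mu.1 i + \sum_i mu.2 i == n]%N.

Definition bipartition n := {mu : shape n * shape n | is_bipart mu}.

(* Boxes of the diagram of [la], as pairs (row, column). *)
Definition box n (la : shape n) := {b : 'I_n * 'I_n | (b.2 < la b.1)%N}.

Definition psum N (R : comNzRingType) (x : 'I_N -> R) (k : nat) : R :=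
  \sum_i x i ^+ k.

Definition semistandard n (la : shape n) N (T : {ffun box la -> 'I_N}) : bool :=
  [forall b : box la, forall c : box la,
     (((val b).1 == (val c).1) && ((val b).2 < (val c).2) ==> (T b <= T c))
  && (((val b).2 == (val c).2) && ((val b).1 < (val c).1) ==> (T b < T c))]%N.

Definition schur n (la : shape n) N (R : comNzRingType) (x : 'I_N -> R) : R :=
  \sum_(T : {ffun box la -> 'I_N} | semistandard T) \prod_b x (T b).

(** The Frobenius formula defines the indexing of the irreducible characters by
    bipartitions.  An identity between functions symmetric in infinitely many
    variables [x] and in infinitely many variables [y] means that it holds in
    [N + N] variables for all [N]. *)

Definition frobenius n (chi : bipartition n -> Iirr (B n)) : Prop :=
  forall (s : {perm 'I_n * bool}) (N : nat), s \in B n ->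
  let x i : {mpoly algC[N + N]} := 'X_(lshift N i) in
  let y i : {mpoly algC[N + N]} := 'X_(rshift N i) in
  \prod_(k <- pos_lengths s) (psum x k + psum y k)
    * \prod_(k <- neg_lengths s) (psum x k - psum y k)
  = \sum_la 'chi_(chi la) s *: (schur (val la).1 x * schur (val la).2 y).

Definition Bact n (s : {perm 'I_n * bool}) (p : {mpoly rat[n]}) :
    {mpoly rat[n]} :=
  p \mPo [tuple (-1) ^+ sneg s i *: 'X_(sabs s i) | i < n].

Definition IBgen n (g : {mpoly rat[n]}) : Prop :=
  g@_0%MM = 0 /\
  exists2 h, h \is symmetric & g = h \mPo [tuple 'X_i ^+ 2 | i < n].

Definition inIB n (p : {mpoly rat[n]}) : Prop :=
  exists k (a g : 'I_k -> {mpoly rat[n]}),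
    (forall i, IBgen (g i)) /\ p = \sum_i a i * g i.

Definition IB n : {pred {mpoly rat[n]}} := fun p => `[< inIB p >].
Arguments IB : clear implicits.

Lemma IBP n (p : {mpoly rat[n]}) : reflect (inIB p) (p \in IB n).
Proof. exact: asboolP. Qed.

Lemma inIBD n (p q : {mpoly rat[n]}) : inIB p -> inIB q -> inIB (p + q).
Proof.
case=> [k [a [g [gP ->]]]] [l [b [h [hP ->]]]]; exists (k + l)%N.
exists (fun i => match split i with inl j => a j | inr j => b j end).
exists (fun i => match split i with inl j => g j | inr j => h j end).
split=> [i|]; first by case: (split i).
rewrite big_split_ord /=; congr (_ + _); apply: eq_bigr => i _.
  by rewrite (unsplitK (inl i)).
by rewrite (unsplitK (inr i)).
Qed.

Lemma inIBM n (q p : {mpoly rat[n]}) : inIB p -> inIB (q * p).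
Proof.
case=> [k [a [g [gP ->]]]]; exists k, (fun i => q * a i), g; split=> //.
by rewrite mulr_sumr; apply: eq_bigr => i _; rewrite mulrA.
Qed.

Lemma inIB0 n : inIB (0 : {mpoly rat[n]}).
Proof. by exists 0%N, (fun=> 0), (fun=> 0); split=> [[]|]; rewrite ?big_ord0. Qed.

Lemma IB_zmod_closed n : zmod_closed (IB n).
Proof.
split=> [|p q /IBP pI /IBP qI]; first exact/IBP/inIB0.
by apply/IBP/inIBD=> //; rewrite -mulN1r; apply: inIBM.
Qed.
HB.instance Definition _ n := GRing.isZmodClosed.Build _ (IB n) (IB_zmod_closed n).

Definition coinv n := {ideal_quot (IB n)}.
HB.instance Definition _ n := GRing.Zmodule.on (coinv n).

Definition psiB n (p : {mpoly rat[n]}) : coinv n := \pi_({ideal_quot (IB n)})%qT p.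

Lemma psiB_eq n (p q : {mpoly rat[n]}) : psiB p = psiB q <-> inIB (p - q).
Proof.
rewrite /psiB; split=> [/eqP|pq].
  by rewrite -Quotient.idealrBE => /IBP.
by apply/eqP; rewrite -Quotient.idealrBE; apply/IBP.
Qed.

Lemma psiBD n (p q : {mpoly rat[n]}) : psiB (p + q) = psiB p + psiB q.
Proof. exact: Quotient.pi_add. Qed.

Lemma psiB_repr n (u : coinv n) : psiB (generic_quotient.repr u) = u.
Proof. exact: reprK. Qed.

(* [psiB] is the projection of the polynomial ring onto its quotient by the
   ideal; the scaling and the action below are those making it linear and
   equivariant (see [psiBZ] and [Bactq_psiB]). *)
Definition coinv_scale n (a : rat) (u : coinv n) : coinv n := psiB (a *: generic_quotient.repr u).

Lemma psiBZ n a (p : {mpoly rat[n]}) : psiB (a *: p) = coinv_scale a (psiB p).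
Proof.
apply/psiB_eq; rewrite -scalerBr -mul_mpolyC; apply: inIBM.
by apply/psiB_eq; rewrite psiB_repr.
Qed.

Lemma coinv_scaleA n a b (u : coinv n) :
  coinv_scale a (coinv_scale b u) = coinv_scale (a * b) u.
Proof. by rewrite -[u]psiB_repr -!psiBZ scalerA. Qed.
Lemma coinv_scale1 n : left_id 1 (@coinv_scale n).
Proof. by move=> u; rewrite -[u]psiB_repr -psiBZ scale1r. Qed.
Lemma coinv_scaleDr n : right_distributive (@coinv_scale n) +%R.
Proof.
by move=> a u v; rewrite -[u]psiB_repr -[v]psiB_repr -psiBD -!psiBZ -psiBD scalerDr.
Qed.
Lemma coinv_scaleDl n (u : coinv n) :
  {morph (@coinv_scale n)^~ u : a b / a + b}.
Proof. by move=> a b; rewrite -[u]psiB_repr -!psiBZ -psiBD scalerDl. Qed.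
HB.instance Definition _ n := GRing.Zmodule_isLmodule.Build rat (coinv n)
  (@coinv_scaleA n) (@coinv_scale1 n) (@coinv_scaleDr n) (@coinv_scaleDl n).

Lemma psiB_is_linear n : linear (@psiB n).
Proof. by move=> a p q; rewrite psiBD psiBZ. Qed.
HB.instance Definition _ n :=
  GRing.isLinear.Build rat {mpoly rat[n]} (coinv n) *:%R (@psiB n)
    (@psiB_is_linear n).

Definition Bactq n (s : {perm 'I_n * bool}) (u : coinv n) : coinv n :=
  psiB (Bact s (generic_quotient.repr u)).

Section BactTheory.

Variable n : nat.
Implicit Types (s t : {perm 'I_n * bool}) (p q : {mpoly rat[n]}).

Lemma sabs_inj s : s \in B n -> injective (sabs s).
Proof.
move=> /BsetP sP i j; rewrite /sabs => eqij.
have := perm_inj (s := s).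
have [eqs|neqs] := eqVneq (s (i, false)).2 (s (j, false)).2.
  suff /perm_inj[] : s (i, false) = s (j, false) by [].
  by apply/eqP; rewrite -pair_eqE /= eqij eqs !eqxx.
suff /perm_inj[] : s (i, false) = s (opp_signed (j, false)) by [].
rewrite sP; apply/eqP; rewrite -pair_eqE /= eqij eqxx /=.
by case: (s (i, false)).2 neqs; case: (s (j, false)).2.
Qed.

Lemma BactX s i : Bact s 'X_i = (-1) ^+ sneg s i *: 'X_(sabs s i).
Proof. by rewrite /Bact comp_mpolyXU -tnth_nth tnth_mktuple. Qed.

Lemma eq_morph (f g : {mpoly rat[n]} -> {mpoly rat[n]}) :
  linear f -> linear g -> monoid_morphism f -> monoid_morphism g ->
  (forall i, f 'X_i = g 'X_i) -> f =1 g.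
Proof.
move=> fL gL fM gM fg p.
pose f' := HB.pack_for {lrmorphism {mpoly rat[n]} -> {mpoly rat[n]}} f
  (GRing.isLinear.Build _ _ _ _ f fL) (GRing.isMonoidMorphism.Build _ _ f fM).
pose g' := HB.pack_for {lrmorphism {mpoly rat[n]} -> {mpoly rat[n]}} g
  (GRing.isLinear.Build _ _ _ _ g gL) (GRing.isMonoidMorphism.Build _ _ g gM).
rewrite -[f]/(f' : _ -> _) -[g]/(g' : _ -> _) [p]mpolyE !linear_sum.
apply: eq_bigr => m _; rewrite !linearZ mpolyXE_id !rmorph_prod.
by congr (_ *: _); apply: eq_bigr => i _; rewrite !rmorphXn /= fg.
Qed.

Lemma Bact_linear s : linear (Bact s).
Proof. exact: linearP. Qed.

Lemma Bact_monoid s : monoid_morphism (Bact s).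
Proof. by split=> [|p q]; rewrite /Bact (rmorph1, rmorphM). Qed.

HB.instance Definition _ s :=
  GRing.isLinear.Build rat _ _ _ (Bact s) (Bact_linear s).
HB.instance Definition _ s :=
  GRing.isMonoidMorphism.Build _ _ (Bact s) (Bact_monoid s).

Lemma Bact1 p : Bact 1 p = p.
Proof.
apply: (@eq_morph (Bact 1) id); rewrite ?(rmorph1) //.
- exact: linearP.
- exact: Bact_monoid.
by move=> i; rewrite BactX /sneg /sabs perm1 scale1r.
Qed.

Lemma BactM s t p : t \in B n -> Bact (s * t) p = Bact t (Bact s p).
Proof.
move=> /BsetP tP; apply: (@eq_morph (Bact (s * t)) (Bact t \o Bact s)).
- exact: linearP.
- exact: linearP.
- exact: Bact_monoid.
- by split=> [|x y] /=; rewrite (rmorph1, rmorphM) /= ?rmorph1 ?rmorphM.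
move=> i /=; rewrite !BactX linearZ /= BactX scalerA -signr_addb /sneg /sabs permM.
case: (s (i, false)) => j [] //=.
by rewrite -[(j, true)]/(opp_signed (j, false)) tP /=; case: (t (j, false)) => k [].
Qed.

(* Signed permutations of the variables permute the monomials up to sign. *)
Lemma BactXm s (m : 'X_{1..n}) : s \in B n ->
  exists e : rat, exists t : 'S_n,
    Bact s 'X_[m] = e *: 'X_[[multinom m (t i) | i < n]].
Proof.
move=> sB; pose a := perm (sabs_inj sB).
exists (\prod_i ((-1) ^+ sneg s i) ^+ m i), a^-1%g.
rewrite [in RHS]mpolyXE_id [X in _ *: X](reindex_inj (@perm_inj _ a)) /=.
rewrite /Bact comp_mpolyX -scaler_prod; apply: eq_bigr => i _.
by rewrite tnth_mktuple mnmE permK exprZn permE.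
Qed.

Lemma inIB_Bact s p : s \in B n -> inIB p -> inIB (Bact s p).
Proof.
move=> sB [k [b [g [gP ->]]]].
exists k, (fun i => Bact s (b i)), g; split=> //.
rewrite linear_sum; apply: eq_bigr => i _; rewrite rmorphM /=; congr (_ * _).
have [_ [h hsym ->]] := gP i.
pose a := perm (sabs_inj sB).
rewrite -[h in RHS](issymP _ hsym a) msym_mPo.
rewrite ![h \mPo _]comp_mpolyEX linear_sum; apply: eq_bigr => m _.
rewrite linearZ /= !comp_mpolyX rmorph_prod; congr (_ *: _).
apply: eq_bigr => j _; rewrite !tnth_mktuple !rmorphXn /= BactX exprZn.
by rewrite sqrr_sign scale1r permE.
Qed.

Lemma Bactq_psiB s p : s \in B n -> Bactq s (psiB p) = psiB (Bact s p).
Proof.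
move=> sB; apply/psiB_eq; rewrite -linearB /=; apply: inIB_Bact => //.
by apply/psiB_eq; rewrite psiB_repr.
Qed.

End BactTheory.

(** Dominance is extended verbatim (partial sums) to arbitrary vectors; since
    [mpart m] is weakly decreasing, a vector that is not weakly decreasing is
    never equal to some [mpart m], and the corresponding R^B is zero. *)

Definition mpart n (m : 'X_{1..n}) : seq nat := sort geq m.

Definition dominated (a b : seq nat) : Prop :=
  sumn a = sumn b /\ forall k, (sumn (take k a) <= sumn (take k b))%N.

(* The span of a set of monomials consists of the polynomials whose monomials
   all belong to it. *)
Definition P_le n (la : n.-tuple nat) (p : {mpoly rat[n]}) : Prop :=
  forall m, m \in msupp p -> dominated (mpart m) la.

Definition P_lt n (la : n.-tuple nat) (p : {mpoly rat[n]}) : Prop :=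
  forall m, m \in msupp p -> dominated (mpart m) la /\ mpart m <> la.

Definition psi_image n (P : {mpoly rat[n]} -> Prop) (u : coinv n) : Prop :=
  exists2 p, P p & psiB p = u.

Section ImageTheory.

Variables (n : nat) (K : seq nat -> Prop).

Let P (p : {mpoly rat[n]}) := forall m, m \in msupp p -> K (mpart m).

Lemma psi_image0 : psi_image P 0.
Proof. by exists 0; [move=> m; rewrite msupp0 | rewrite linear0]. Qed.

Lemma psi_imageD u v :
  psi_image P u -> psi_image P v -> psi_image P (u + v).
Proof.
case=> [p Pp <-] [q Pq <-]; exists (p + q); last by rewrite linearD.
by move=> m /msuppD_le; rewrite mem_cat => /orP[/Pp|/Pq].
Qed.

Lemma psi_imageZ a u : psi_image P u -> psi_image P (a *: u).
Proof.
case=> [p Pp <-]; exists (a *: p); last by rewrite linearZ.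
by move=> m /msuppZ_le /Pp.
Qed.

Lemma psi_image_act s u :
  s \in B n -> psi_image P u -> psi_image P (Bactq s u).
Proof.
move=> sB [p Pp <-]; rewrite Bactq_psiB //.
have -> : Bact s p = \sum_(m <- msupp p) p@_m *: Bact s 'X_[m].
  exact: comp_mpolyEX.
rewrite linear_sum big_seq.
elim/big_ind: _ => [|x y|m /Pp Pm]; [exact: psi_image0|exact: psi_imageD|].
rewrite linearZ /=; apply: psi_imageZ.
have [e [t ->]] := BactXm m sB; rewrite linearZ /=; apply: psi_imageZ.
eexists; last by reflexivity.
move=> m'; rewrite msuppX inE => /eqP ->.
suff -> : mpart [multinom m (t i) | i < n] = mpart m by [].
apply/perm_sortP; [by move=> x y; apply: leq_total| | |].
- by move=> x y z /= xy yz; apply: leq_trans xy.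
- by move=> x y /= /andP[xy yx]; apply/eqP; rewrite eqn_leq xy yx.
by apply/tuple_permP; exists t; congr val; apply: eq_from_tnth => i;
  rewrite !tnth_mktuple.
Qed.

Lemma psi_image_fingen D : (forall m : 'X_{1..n}, K (mpart m) -> mdeg m = D) ->
  exists k (f : 'I_k -> coinv n), (forall i, psi_image P (f i)) /\
  forall u, psi_image P u -> exists c : 'I_k -> rat, u = \sum_i c i *: f i.
Proof.
move=> KD; pose A : {pred 'X_{1..n < D.+1}} := fun m => `[< K (mpart m) >].
pose T := {m | m \in A}.
pose mon (t : T) : 'X_{1..n} := bmnm (val t).
exists #|(predT : {pred T})|, (fun i => psiB 'X_[mon (enum_val i)]).
split=> [i|_ [p Pp <-]].
  eexists; last by reflexivity.
  move=> m; rewrite msuppX inE => /eqP ->.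
  exact/asboolP/(valP (enum_val i)).
exists (fun i => p@_(mon (enum_val i))).
rewrite -(big_enum_val (A := predT) (fun t => p@_(mon t) *: psiB 'X_[mon t])).
have le_pD : (msize p <= D.+1)%N.
  by rewrite msizeE; apply/bigmax_leqP_seq => m mp _; rewrite ltnS KD //; apply: Pp.
rewrite {1}[p](mpolywE le_pD) linear_sum.
rewrite [LHS](bigID (mem A)) /=.
rewrite [X in _ + X]big1 ?addr0 => [|m /asboolPn nKm]; last first.
  rewrite memN_msupp_eq0 ?scale0r ?linear0 //.
  by apply/negP=> /Pp.
by rewrite big_sub; apply: eq_bigr => x _; rewrite linearZ.
Qed.

End ImageTheory.

Lemma mpart_sumn n (m : 'X_{1..n}) : sumn (mpart m) = mdeg m.
Proof.
rewrite /mdeg sumnE; apply: perm_big; rewrite perm_sort; exact: perm_refl.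
Qed.

Lemma RB_exists n (la : n.-tuple nat) :
  exists d, exists rG : mx_representation rat (B n) d,
    affords (@Bactq n) (psi_image (P_le la)) (psi_image (P_lt la)) rG.
Proof.
pose Kle x := dominated x la; pose Klt x := dominated x la /\ x <> la.
apply: affords_exists.
- exact: (@psi_image0 n Klt).
- exact: (@psi_imageD n Klt).
- exact: (@psi_imageZ n Klt).
- move=> s u v sB; rewrite -[u]psiB_repr -[v]psiB_repr -linearD /=.
  by rewrite !Bactq_psiB // !linearD.
- move=> s a u sB; rewrite -[u]psiB_repr -linearZ /=.
  by rewrite !Bactq_psiB // !linearZ.
- by move=> u; rewrite /Bactq Bact1 psiB_repr.
- move=> s t sB tB u; rewrite -[u]psiB_repr !Bactq_psiB ?groupM //.
  by rewrite BactM.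
- exact: (@psi_image_act n Kle).
- exact: (@psi_image_act n Klt).
apply: (@psi_image_fingen n Kle (sumn la)) => m [<- _].
by rewrite mpart_sumn.
Qed.

Definition RBdim n (la : n.-tuple nat) : nat := projT1 (cid (RB_exists la)).

Definition RB n (la : n.-tuple nat) : mx_representation rat (B n) (RBdim la) :=
  projT1 (cid (projT2 (cid (RB_exists la)))).

Lemma RB_affords n (la : n.-tuple nat) :
  affords (@Bactq n) (psi_image (P_le la)) (psi_image (P_lt la)) (RB la).
Proof. exact: projT2 (cid (projT2 (cid (RB_exists la)))). Qed.

(* After extension of scalars to [algC], [rG] is the direct sum over [i] of
   [multiplicity rG i] copies of the [i]-th irreducible representation (see
   [mx_rsim_standard]). *)
Definition multiplicity (gT : finGroupType) (G : {group gT}) d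
    (rG : mx_representation rat G d) (i : Iirr G) : nat :=
  standard_irr_coef (map_repr (ratr : {rmorphism rat -> algC}) rG)
    (socle_of_Iirr i).

(** Entries and positions are shifted by one: [v : 'I_n] stands for [v + 1] in
    [[n]], and [i : 'I_n.-1] for [i + 1] in [[n - 1]]. *)

Definition lambda_SS n (S1 : {set 'I_n.-1}) (S2 : {set 'I_n}) : n.-tuple nat :=
  [tuple (2 * #|[set j in S1 | i <= j]| + (i \in S2))%N | i < n].

(* [inl] boxes are those of the diagram of [mu^1], [inr] boxes those of the
   diagram of [mu^2], placed below. *)
Definition bibox n (mu : shape n * shape n) := (box mu.1 + box mu.2)%type.

Definition rows_below n (mu : shape n * shape n) (b c : bibox mu) : bool :=
  match b, c with
  | inl b, inl c => ((val b).1 < (val c).1)%N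
  | inr b, inr c => ((val b).1 < (val c).1)%N
  | inl _, inr _ => true
  | inr _, inl _ => false
  end.

(* [c] is to the right of [b] in the same row, or below [b] in the same column,
   of the same diagram. *)
Definition box_lt n (la : shape n) (b c : box la) : bool :=
  (((val b).1 == (val c).1) && ((val b).2 < (val c).2)
   || ((val b).2 == (val c).2) && ((val b).1 < (val c).1))%N.
Definition bibox_lt n (mu : shape n * shape n) (b c : bibox mu) : bool :=
  match b, c with
  | inl b, inl c => box_lt b c
  | inr b, inr c => box_lt b c
  | _, _ => false
  end.

Definition is_SYT n (mu : shape n * shape n) (T : {ffun bibox mu -> 'I_n}) :
    bool :=
  [forall v, #|[set b | T b == v]| == 1%N] &&
  [forall b : bibox mu, forall c : bibox mu, bibox_lt b c ==> (T b < T c)%N].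

Definition SYT n (mu : bipartition n) : {set {ffun bibox (val mu) -> 'I_n}} :=
  [set T | is_SYT T].

Definition Des n (mu : shape n * shape n) (T : {ffun bibox mu -> 'I_n}) :
    {set 'I_n.-1} :=
  [set i : 'I_n.-1 | [exists b : bibox mu, exists c : bibox mu,
     [&& T b == i :> nat, T c == i.+1 :> nat & rows_below b c]]].

Definition Neg n (mu : shape n * shape n) (T : {ffun bibox mu -> 'I_n}) :
    {set 'I_n} :=
  [set T (inr b) | b : box mu.2].

(* Main.v *)
(** For a monomial [m], sort the positions by decreasing exponent, ties by index.
    Adding [2] to the exponents of the [k] first positions gives the leading
    monomial of [e_k(x_1^2, ..., x_n^2) m], for dominance refined by the
    lexicographic order.  Every monomial arises in a unique way from a reduced one
    by such steps; replacing them with products by the [e_k] yields a basis of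
    the polynomial ring, unitriangular in the monomials, whose non-reduced elements
    span the ideal.  Hence the trace of a group element on R_lambda is the sum, over
    the reduced monomials above lambda, of diagonal weights that the steps leave
    invariant, while the sum over all monomials above lambda is its trace on the
    span of these monomials.

    By the Frobenius formula and standardization, an irreducible representation
    occurs in that span as many times as there are standard tableaux [T] such that
    Neg(T) is the set of odd positions of lambda and Des(T) is contained in the set
    of strict descents of lambda.  Removing the non-reduced objects is the same
    inclusion-exclusion for monomials and for tableaux, which gives the theorem
    once the indexing by bipartitions is known to be injective.  It is surjective,
    because a sum of the above traces is a multiple of the regular character, and
    there are at least as many conjugacy classes as bipartitions. *)

Require Import Defs.
From HB Require Import structures.
From mathcomp Require Import all_boot all_fingroup all_algebra all_character.
From mathcomp Require Import all_order all_field boolp zify ring.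
From mathcomp Require Import mpoly.

Set Implicit Arguments.
Unset Strict Implicit.
Unset Printing Implicit Defensive.

Import GRing.Theory.

(** * Ranks in a strict total order *)

(** No correspondence between monomials and tableaux is built: traces carry signs, so the two sides
    are compared only as class functions. The Frobenius formula knows the span of all monomials
    above an exponent sequence, while R_lambda sees the reduced ones. The passage is made one
    position at a time: [weight_sum la D] and [reduced_SYT la D] impose reducedness at the positions
    of [D] only, and satisfy the same recursion. Each step trades [la] for [la] lowered by 2 on its
    first entries, so the comparison has to cover every weakly decreasing [la], although the theorem
    concerns only the sequences attached to [S1] and [S2]. Diagonal coefficients in the monomial
    basis are not constant along the steps, because a step may break ties between exponents; those
    in the adapted basis are constant. The representations are never constructed: [chi] is known
    through the formula alone, so the injectivity that keeps two multiplicities from merging must be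
    extracted from that formula too. *)

Section StrictTotalOrder.

Variables (T : finType) (R : rel T).

Definition strict_total :=
  [/\ irreflexive R, transitive R & forall x y, x != y -> R x y || R y x].

Definition rank (x : T) : nat := #|[set y | R y x]|.

Hypothesis Rtot : strict_total.

Lemma rank_lt x y : (rank x < rank y) = R x y.
Proof.
have [irr tr tot] := Rtot.
have mono a b : R a b -> rank a < rank b.
  move=> Rab; apply: proper_card; apply/properP; split.
    by apply/subsetP=> z; rewrite !inE => /tr; apply.
  by exists a; rewrite !inE ?irr.
apply/idP/idP=> [lt_xy|/mono //].
have [eq_xy|/tot/orP[//|/mono]] := eqVneq x y; first by rewrite eq_xy ltnn in lt_xy.
by rewrite ltnNge ltnW.
Qed.

Lemma rank_inj : injective rank.
Proof.
have [irr tr tot] := Rtot => x y eq_r; apply/eqP/negPn/negP=> /tot.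
by rewrite -!rank_lt eq_r ltnn.
Qed.

Lemma rank_max x : rank x < #|T|.
Proof.
have [irr _ _] := Rtot.
rewrite -cardsT; apply/proper_card/properP; split; first exact: subsetT.
by exists x; rewrite !inE ?irr.
Qed.

Lemma rank_onto k : k < #|T| -> exists x, rank x = k.
Proof.
move=> lt_k; pose f x := Ordinal (rank_max x).
have /inj_card_onto : injective f by move=> x y [/rank_inj].
rewrite card_ord leqnn => /(_ isT (Ordinal lt_k))/codomP[x def_k].
by exists x; rewrite -[k]/(val (Ordinal lt_k)) def_k.
Qed.

(** The predecessors of [x] are carried by [Q] onto the ordinals below [Q x]. This recovers a
    standard tableau from the order of its boxes. *)
Lemma rank_unique n (Q : T -> 'I_n) :
  bijective Q -> (forall x y, (Q x < Q y) = R x y) -> forall x, Q x = rank x :> nat.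
Proof.
move=> bijQ QR x; have [Q' QK Q'K] := bijQ.
rewrite -[LHS](card_ord (Q x)) /rank.
have le_Qn : Q x <= n := ltnW (ltn_ord (Q x)).
rewrite -(card_imset _ (bij_inj bijQ)).
have inj_w : injective (widen_ord le_Qn) by move=> i j /(congr1 val)/= /val_inj.
rewrite -(card_imset _ inj_w); apply: eq_card => i; apply/imsetP/imsetP=> -[].
  by move=> j _ ->; exists (Q' (widen_ord le_Qn j)); rewrite ?Q'K // inE -QR Q'K /=.
move=> y; rewrite inE -QR => lt_y ->.
by exists (Ordinal lt_y) => //; apply: val_inj.
Qed.

(** The entries above [v] form an initial segment, and the default 0 is above nothing. Sorted
    sequences can thus be compared threshold by threshold. *)
Lemma ltn_nth_sorted (s : seq nat) v i :
  sorted geq s -> (v < nth 0 s i) = (i < count (ltn v) s).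
Proof.
have tr : transitive geq by move=> y x z /= yx zy; apply: leq_trans yx.
elim: s i => [|a s IHs] i /=; first by rewrite nth_nil.
move=> /[dup] /path_sorted/IHs{}IHs; rewrite path_sortedE // => /andP[/allP le_a _].
have [lt_va|le_av] := ltnP v a; first by case: i => [|i] /=; rewrite ?lt_va ?IHs.
have -> : count (ltn v) s = 0.
  by apply/eqP; rewrite -leqn0 leqNgt -has_count; apply/hasPn=> b /le_a /=; lia.
case: i => [|i] /=; first by lia.
apply/idP/idP=> //; have [lt_is|] := ltnP i (size s); last by move/(nth_default 0)->.
by have /= := le_a _ (mem_nth 0 lt_is); lia.
Qed.

Lemma nth_rank (f : T -> nat) s x : (forall y z, R y z -> f z <= f y) ->
  sorted geq s -> perm_eq s [seq f y | y <- enum T] -> nth 0 s (rank x) = f x.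
Proof.
have [irr tr tot] := Rtot => fR s_sort s_f.
(* The elements with [f] above [v] are closed under predecessors, so [x] is one of them exactly when
   its rank is below their number. *)
have lt_eq v : (v < nth 0 s (rank x)) = (v < f x).
  rewrite ltn_nth_sorted // (seq.permP s_f) count_map.
  have -> : count (preim f (ltn v)) (enum T) = #|[set y | v < f y]|.
    by rewrite cardsE -sum1_card -sum1_count big_enum_cond.
  apply/idP/idP=> [|lt_v].
    apply: contraLR; rewrite -!leqNgt => le_v; apply: subset_leq_card.
    apply/subsetP=> y; rewrite !inE => lt_v.
    have /tot/orP[//|/fR] : y != x by apply: contraTneq lt_v => ->; lia.
    lia.
  apply: proper_card; apply/properP; split; last by exists x; rewrite inE ?irr.
  by apply/subsetP=> y; rewrite !inE => /fR; lia.
by have := lt_eq (f x); have := lt_eq (nth 0 s (rank x)); lia.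
Qed.

End StrictTotalOrder.

(** * Leading monomials *)

Section Monomials.

Variable n : nat.
Implicit Types (m : 'X_{1..n}) (i j : 'I_n) (h : {set 'I_n}).

Definition before m : rel 'I_n :=
  fun i j => (m j < m i) || (m i == m j) && (i < j).

Lemma before_total m : strict_total (before m).
Proof.
split=> [i | j i k | i j ne_ij]; rewrite /before; try by lia.
have : i != j :> nat by apply: contraNneq ne_ij => /val_inj->.
lia.
Qed.

Definition mrank m i : nat := rank (before m) i.

Lemma mrank_lt m i j : (mrank m i < mrank m j) = before m i j.
Proof. exact: rank_lt (before_total m) i j. Qed.

Lemma mrank_inj m : injective (mrank m).
Proof. exact: rank_inj (before_total m). Qed.

Lemma mrank_max m i : mrank m i < n.
Proof. by have := rank_max (before_total m) i; rewrite card_ord. Qed.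

Lemma mrank_onto m k : k < n -> exists i, mrank m i = k.
Proof. by move=> lt_k; apply: rank_onto (before_total m) _ _; rewrite card_ord. Qed.

Lemma size_mpart m : size (mpart m) = n.
Proof. by rewrite size_sort size_tuple. Qed.

Lemma sorted_mpart m : sorted geq (mpart m).
Proof. by apply: sort_sorted => x y; apply: leq_total. Qed.

Lemma perm_mpart m : perm_eq (mpart m) [seq m i | i <- enum 'I_n].
Proof.
rewrite perm_sort -[X in perm_eq X]map_tnth_enum.
by rewrite (eq_map (mnm_tnth m)) perm_refl.
Qed.

Lemma nth_mpart m i : nth 0 (mpart m) (mrank m i) = m i.
Proof.
apply: (nth_rank (before_total m)); last exact: perm_mpart.
  by move=> j k; rewrite /before; lia.
exact: sorted_mpart.
Qed.

(* [up k m] is the leading monomial of [e_{k+1}(x_1^2, ..., x_n^2) * 'X_[m]] for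
   the order [prec] below. *)
Definition dbl h : 'X_{1..n} := [multinom (2 * (i \in h))%N | i < n].
Definition top m (k : nat) : {set 'I_n} := [set i | mrank m i <= k].
Definition up (k : nat) m : 'X_{1..n} := (m + dbl (top m k))%MM.

Lemma upE k m i : up k m i = m i + 2 * (mrank m i <= k).
Proof. by rewrite mnmDE mnmE inE. Qed.

(** Raising an initial segment of the order only widens its distance to the rest, so ranks survive;
    this is what makes [up k] reversible. *)
Lemma before_up k m : before (up k m) =2 before m.
Proof.
move=> i j; have := mrank_lt m i j; have := mrank_lt m j i.
by rewrite /before !upE; case: leqP; case: leqP => /=; lia.
Qed.

Lemma mrank_up k m : mrank (up k m) =1 mrank m.
Proof. by move=> i; apply: eq_card => j; rewrite !inE before_up. Qed.

Lemma up_inj k : injective (up k).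
Proof.
move=> m1 m2 eq_up; have eq_r : mrank m1 =1 mrank m2.
  by move=> i; rewrite -(mrank_up k) eq_up mrank_up.
apply/mnmP=> i; have /mnmP/(_ i) := eq_up; rewrite !upE eq_r; lia.
Qed.

Definition addk k (s : seq nat) := mkseq (fun l => nth 0 s l + 2 * (l <= k)) (size s).

Lemma mpart_up k m : mpart (up k m) = addk k (mpart m).
Proof.
apply: (@eq_from_nth _ 0) => [|l]; rewrite !size_mpart ?size_mkseq ?size_mpart // => lt_l.
rewrite nth_mkseq ?size_mpart //; have [i <-] := mrank_onto m lt_l.
by rewrite nth_mpart -{1}(mrank_up k) nth_mpart upE.
Qed.

Lemma addk_inj k (s t : seq nat) : size s = size t -> addk k s = addk k t -> s = t.
Proof.
move=> sz_st eq_st; apply: (@eq_from_nth _ 0) => // l lt_l.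
have := congr1 (nth 0 ^~ l) eq_st; rewrite !nth_mkseq -?sz_st //; lia.
Qed.

Lemma nth_mpart_up k m l : l < n ->
  nth 0 (mpart (up k m)) l = nth 0 (mpart m) l + 2 * (l <= k).
Proof. by move=> lt_l; rewrite mpart_up nth_mkseq ?size_mpart. Qed.

Lemma nth_mpart_S m l : nth 0 (mpart m) l.+1 <= nth 0 (mpart m) l.
Proof.
have [lt_l|ge_l] := ltnP l.+1 n; last by rewrite nth_default ?size_mpart.
have tr : transitive geq by move=> y x z /= yx zy; apply: leq_trans yx.
by apply: (sortedP 0 (sorted_mpart m)); rewrite size_mpart.
Qed.

(* [red m k] counts how many times [up k] can be undone: the difference between
   the exponents of ranks [k] and [k + 1] must stay nonnegative, and positive when
   the position of rank [k] comes after that of rank [k + 1].  The value [0] of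
   [nth] past the end makes the last exponent its own difference. *)
Definition gap (s : seq nat) (k : nat) (b : bool) : nat :=
  (nth 0 s k - nth 0 s k.+1 - b)./2.

Definition mdesc m k : bool :=
  [exists i, exists j, [&& mrank m i == k, mrank m j == k.+1 & (j < i)]].

Definition red m k := gap (mpart m) k (mdesc m k).

Lemma mdesc_up l m k : mdesc (up l m) k = mdesc m k.
Proof. by apply: eq_existsb => i; apply: eq_existsb => j; rewrite !mrank_up. Qed.

Lemma mdesc_gap m k : mdesc m k -> nth 0 (mpart m) k.+1 < nth 0 (mpart m) k.
Proof.
case/existsP=> i /existsP[j /and3P[/eqP<- /eqP rk_j lt_ji]].
have := mrank_lt m i j; rewrite rk_j ltnS leqnn -rk_j !nth_mpart /before; lia.
Qed.

(** The step widens by 2 the difference at [k] and no other. By [mdesc_gap] the descent correction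
    is never truncated, so halving turns this 2 into exactly one. *)
Lemma red_up k m l : k < n -> l < n -> red (up k m) l = red m l + (l == k).
Proof.
move=> lt_k lt_l; rewrite /red /gap mdesc_up nth_mpart_up //.
have := nth_mpart_S m l; have := @mdesc_gap m l.
have [lt_Sl|ge_Sl] := ltnP l.+1 n.
  by rewrite nth_mpart_up //; case: (mdesc m l) => [/(_ isT)|_]; lia.
rewrite ![nth _ _ l.+1]nth_default ?size_mpart //.
by case: (mdesc m l) => [/(_ isT)|_]; lia.
Qed.

Lemma red_gt0 m k : k < n -> 0 < red m k -> exists m', m = up k m'.
Proof.
move=> lt_kn; rewrite /red /gap => red_k.
pose m' := [multinom m i - 2 * (mrank m i <= k) | i < n].
have m'E i : m' i = m i - 2 * (mrank m i <= k) by rewrite mnmE.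
have [ik rk_ik] := mrank_onto m lt_kn.
have le_top i : mrank m i <= k -> m ik <= m i.
  by rewrite -rk_ik leqNgt mrank_lt /before; lia.
have m_ik : nth 0 (mpart m) k = m ik by rewrite -rk_ik nth_mpart.
(* Exponents inside the top must exceed those outside by 2, and a difference of exactly 2 becomes a
   tie, which the indices must then break the same way. *)
have in_out i j : mrank m i <= k -> k < mrank m j -> m j + 2 <= m i /\
    (m j + 2 = m i -> i < j).
  move=> top_i out_j; have := le_top i top_i.
  have lt_Sk : k.+1 < n by apply: leq_trans (mrank_max m j).
  have [jk rk_jk] := mrank_onto m lt_Sk.
  have m_jk : nth 0 (mpart m) k.+1 = m jk by rewrite -rk_jk nth_mpart.
  have := mrank_lt m j jk; have := mrank_lt m ik i.
  have ned : ~~ (jk < ik) -> ik < jk.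
    rewrite -leqNgt leq_eqVlt => /orP[/eqP/val_inj eq_i|//].
    by move: rk_jk; rewrite -eq_i rk_ik; lia.
  have : (jk < ik) -> mdesc m k.
    by move=> lt_i; apply/existsP; exists ik; apply/existsP; exists jk; rewrite rk_ik rk_jk !eqxx.
  move: red_k; rewrite m_ik m_jk rk_ik rk_jk /before; case: (mdesc m k) => /=.
    by lia.
  by move=> red_k /contraNN/(_ isT)/ned; lia.
have ge2 i : mrank m i <= k -> 2 <= m i.
  by move/le_top; rewrite -m_ik; lia.
have bf : before m' =2 before m.
  move=> i j; rewrite /before !m'E; have := @in_out i j; have := @in_out j i.
  have := @ge2 i; have := @ge2 j.
  have [|] := leqP (mrank m i) k; have [|] := leqP (mrank m j) k => /=.
  - by move=> _ _ /(_ isT) ? /(_ isT) ? _ _; lia.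
  - by move=> _ _ _ /(_ isT) ? _ /(_ isT isT) ?; lia.
  - by move=> _ _ /(_ isT) ? _ /(_ isT isT) ? _; lia.
  - by rewrite muln0 !subn0.
exists m'; apply/mnmP=> i; rewrite upE m'E.
have -> : mrank m' i = mrank m i by apply: eq_card => j; rewrite !inE bf.
have [|] := leqP (mrank m i) k => /=; last by rewrite muln0 subn0 addn0.
by move/ge2; lia.
Qed.

End Monomials.

(** * Dominance of sorted exponents and leading terms *)

Section Dominance.

Lemma dominated_refl (s : seq nat) : dominated s s.
Proof. by split. Qed.

Lemma dominated_trans (t s u : seq nat) : dominated s t -> dominated t u -> dominated s u.
Proof. by case=> e1 d1 [e2 d2]; split=> [|k]; [rewrite e1|apply: leq_trans (d1 k) _]. Qed.

Lemma dominated_anti (s t : seq nat) :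
  size s = size t -> dominated s t -> dominated t s -> s = t.
Proof.
move=> sz [_ d1] [_ d2]; apply: (@eq_from_nth _ 0) => // l lt_l.
have eq_d k : sumn (take k s) = sumn (take k t) by have := d1 k; have := d2 k; lia.
have := eq_d l.+1; rewrite (take_nth 0 lt_l) (take_nth 0) -?sz //.
by rewrite !sumn_rcons eq_d => /addnI.
Qed.

Lemma sumn_takeE (s : seq nat) (j : nat) :
  sumn (take j s) = \sum_(l < size s | l < j) nth 0 s l.
Proof.
elim: s j => [|a s IHs] [|j] /=; rewrite ?big_ord0 //; first by rewrite big_pred0.
by rewrite IHs [RHS]big_mkcond /= big_ord_recl /= -big_mkcond.
Qed.

Variable n : nat.
Implicit Types (m : 'X_{1..n}) (h : {set 'I_n}).

Lemma sum_mrank m (F : nat -> nat) : \sum_i F (mrank m i) = \sum_(l < n) F l.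
Proof.
have inj_r : injective (fun i => Ordinal (mrank_max m i)).
  by move=> i j [/mrank_inj].
by rewrite [RHS](reindex_inj inj_r).
Qed.

Lemma sumn_mpart m j : sumn (take j (mpart m)) = \sum_(i | mrank m i < j) m i.
Proof.
rewrite sumn_takeE size_mpart big_mkcond [RHS]big_mkcond /=.
rewrite -(sum_mrank m (fun l => if l < j then nth 0 (mpart m) l else 0)).
by apply: eq_bigr => i _; rewrite nth_mpart.
Qed.

Lemma card_mrank m j : #|[set i | mrank m i < j]| = minn j n.
Proof.
rewrite -sum1_card big_mkcond /=.
under eq_bigr do rewrite inE; rewrite (sum_mrank m (fun l => if l < j then 1 else 0)).
rewrite -big_mkcond sum1_card; have [le_nj|lt_jn] := leqP n j.
  rewrite -[RHS]card_ord; apply: eq_card => l.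
  exact: leq_trans (ltn_ord l) le_nj.
have inj_w : injective (widen_ord (ltnW lt_jn)) by move=> x y /(congr1 val)/= /val_inj.
rewrite -[RHS]card_ord -(card_imset _ inj_w).
apply: eq_card => l; apply/idP/imsetP => [lt_l|[l' _ ->]]; last exact: (ltn_ord l').
by exists (Ordinal lt_l) => //; apply: val_inj.
Qed.

Lemma sum_le_mpart m (C : {set 'I_n}) j :
  #|C| <= j -> \sum_(i in C) m i <= sumn (take j (mpart m)).
Proof.
move=> le_C; rewrite sumn_mpart; pose A := [set i | mrank m i < j].
have -> : \sum_(i | mrank m i < j) m i = \sum_(i in A) m i.
  by apply: eq_bigl => i; rewrite inE.
have le_CA : #|C| <= #|A|.
  by rewrite card_mrank leq_min le_C -[X in _ <= X]card_ord max_card.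
rewrite (big_setID A) [X in _ <= X](big_setID C) /= [C :&: A]setIC leq_add2l.
(* The largest exponent outside [A] separates [A] from the rest, so exchanging [C :\: A] for
   [A :\: C] cannot lower the sum. *)
have [v in_v out_v] : exists2 v, forall i, i \in A -> v <= m i & forall i, i \notin A -> m i <= v.
  exists (\max_(i | i \notin A) m i) => [i Ai|i nAi]; last by rewrite leq_bigmax_cond.
  apply/bigmax_leqP=> l nAl; move: Ai nAl; rewrite !inE -leqNgt => lt_i le_l.
  by have := mrank_lt m i l; rewrite (leq_trans lt_i le_l) /before; lia.
apply: (@leq_trans (#|C :\: A| * v)); last apply: (@leq_trans (#|A :\: C| * v)).
- by rewrite -sum_nat_const leq_sum // => i /setDP[_ /out_v].
- by rewrite leq_mul2r !cardsD [C :&: A]setIC leq_sub2r ?orbT.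
- by rewrite -sum_nat_const leq_sum // => i /setDP[/in_v].
Qed.

Lemma mdeg_dbl h : mdeg (dbl h) = 2 * #|h|.
Proof.
rewrite mdegE -sum1_card big_distrr [RHS]big_mkcond /=; apply: eq_bigr => i _.
by rewrite mnmE; case: (i \in h).
Qed.

Lemma card_top m k : k < n -> #|top m k| = k.+1.
Proof.
move=> lt_k; rewrite -[RHS](minn_idPl lt_k) -(card_mrank m).
by apply: eq_card => i; rewrite !inE.
Qed.

Lemma sum_dbl m h (C : {set 'I_n}) :
  \sum_(i in C) (m + dbl h)%MM i = \sum_(i in C) m i + 2 * #|C :&: h|.
Proof.
under eq_bigr do rewrite mnmDE mnmE; rewrite big_split /=; congr (_ + _).
rewrite -sum1_card big_distrr /= big_mkcond [RHS]big_mkcond /=.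
by apply: eq_bigr => i _; rewrite inE; case: (i \in C); case: (i \in h).
Qed.

Lemma sumn_take_up k m j : k < n ->
  sumn (take j (mpart (up k m))) = sumn (take j (mpart m)) + 2 * minn j k.+1.
Proof.
move=> lt_k; rewrite !sumn_mpart.
have in_A F : \sum_(i | mrank m i < j) F i = \sum_(i in [set i | mrank m i < j]) F i.
  by apply: eq_bigl => i; rewrite inE.
under eq_bigl do rewrite mrank_up.
rewrite !in_A sum_dbl; congr (_ + 2 * _).
have -> : minn j k.+1 = minn (minn j k.+1) n by lia.
by rewrite -(card_mrank m); apply: eq_card => i; rewrite !inE; lia.
Qed.

Lemma dominated_up k m1 m2 : k < n ->
  dominated (mpart m1) (mpart m2) -> dominated (mpart (up k m1)) (mpart (up k m2)).
Proof.
move=> lt_k [eq_s dom]; split=> [|j].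
  by move: eq_s; rewrite !mpart_sumn !mdegD !mdeg_dbl !card_top // => ->.
by rewrite !sumn_take_up // leq_add2r.
Qed.

Lemma mdeg_up k m : k < n -> mdeg (up k m) = mdeg m + 2 * k.+1.
Proof. by move=> lt_k; rewrite mdegD mdeg_dbl card_top. Qed.

Definition initial m j : {set 'I_n} := [set i | mrank m i < j].

Lemma sumn_take_dbl m h j : sumn (take j (mpart (m + dbl h)%MM)) =
  \sum_(i in initial (m + dbl h)%MM j) m i + 2 * #|initial (m + dbl h)%MM j :&: h|.
Proof. by rewrite sumn_mpart -sum_dbl; apply: eq_bigl => i; rewrite inE. Qed.

(** The first [j] positions of [m + dbl h] weigh in [m] at most its [j] largest exponents, and meet
    [h] in at most [minn j k.+1] places; [top m k] attains both bounds. *)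
Lemma dominated_dbl k m h : k < n -> #|h| = k.+1 ->
  dominated (mpart (m + dbl h)%MM) (mpart (up k m)).
Proof.
move=> lt_k card_h; split=> [|j].
  by rewrite !mpart_sumn !mdegD !mdeg_dbl card_top ?card_h.
rewrite sumn_take_up // sumn_take_dbl.
set C := initial _ _; have card_C : #|C| = minn j n by apply: card_mrank.
apply: leq_add; first by apply: sum_le_mpart; rewrite card_C geq_minl.
rewrite leq_mul2l /= leq_min -card_h subset_leq_card ?subsetIr // andbT.
by apply: leq_trans (subset_leq_card (subsetIl _ _)) _; rewrite card_C geq_minl.
Qed.

(** Among the sets of [k.+1] positions with maximal exponent sum, [top m k] takes the smallest
    indices within tied exponents. *)
Lemma lt_dbl k m h : k < n -> #|h| = k.+1 -> h != top m k ->
  mpart (m + dbl h)%MM = mpart (up k m) -> ((m + dbl h)%MM < up k m)%O.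
Proof.
move=> lt_k card_h ne_h eq_part.
(* Equal partial sums of length [k.+1] force the first [k.+1] positions of [m + dbl h] to be [h],
   whose sum in [m] is then maximal. *)
have sum_h : \sum_(i in h) m i = sumn (take k.+1 (mpart m)).
  have := congr1 (fun s => sumn (take k.+1 s)) eq_part.
  rewrite /= sumn_take_up // minnn sumn_take_dbl.
  set C := initial _ _ => eq_S.
  have card_C : #|C| = k.+1 by rewrite card_mrank (minn_idPl lt_k).
  have le_C := sum_le_mpart m (eq_leq card_C).
  have le_Ch : #|C :&: h| <= #|h| by rewrite subset_leq_card ?subsetIr.
  have/eqP sub_h : C :&: h == h by rewrite eqEcard subsetIr; lia.
  have eq_h : h = C.
    by apply/eqP; rewrite eqEcard card_C card_h leqnn andbT -sub_h subsetIl.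
  by move: eq_S; rewrite sub_h card_h -eq_h => /addIn.
have eq_deg : mdeg (m + dbl h)%MM = mdeg (up k m).
  by rewrite -!mpart_sumn eq_part.
apply/(ltmcP eq_deg).
have [i0 ne_i0] : exists i, (i \in h) != (i \in top m k).
  apply/existsP; apply: contraNT ne_h; rewrite negb_exists => /forallP all_eq.
  by apply/eqP/setP=> i; apply/eqP/negPn/all_eq.
pose P := [pred i | (i \in h) != (i \in top m k)].
(* The first index where the two sets differ decides the comparison; it must lie in [top m k]. *)
have [j Pj min_j] := arg_minnP (P := P) (fun i => val i) ne_i0.
exists j => [l lt_lj|].
  have /eqP eq_l : (l \in h) == (l \in top m k).
    by apply: contraTT lt_lj => ne_l; rewrite -leqNgt; apply: min_j.
  by rewrite upE mnmDE mnmE eq_l inE.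
have [in_h|nin_h] := boolP (j \in h); last first.
  move: Pj; rewrite /= (negPf nin_h) inE => top_j.
  by rewrite upE mnmDE mnmE (negPf nin_h); move: top_j; case: (_ <= _) => //=; lia.
have ntop_j : j \notin top m k by move: Pj; rewrite /= in_h; case: (_ \in top _ _).
have /subsetPn[i topi nhi] : ~~ (top m k \subset h).
  apply: contra ne_h => sub_top; rewrite eq_sym eqEcard sub_top.
  by rewrite card_h card_top ?leqnn.
have lt_ij : before m i j.
  by move: topi ntop_j; rewrite !inE -mrank_lt -ltnNge => /leq_ltn_trans; apply.
have le_ji : j <= i by apply: min_j; rewrite inE /= topi (negPf nhi).
have lt_m : m j < m i by move: lt_ij; rewrite /before; lia.
pose h' := i |: h :\ j.
have card_h' : #|h'| = k.+1.
  by rewrite cardsU1 !inE negb_and nhi orbT; have := cardsD1 j h; rewrite in_h; lia.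
have := sum_le_mpart m (eq_leq card_h').
rewrite -sum_h (big_setD1 j in_h) big_setU1 /=; last by rewrite !inE negb_and nhi orbT.
by rewrite leq_add2r leqNgt lt_m.
Qed.

(** The first term depends only on [m i] and the sorted exponents, the second only on exponents up
    to [i], which allows ranks to be compared between rearrangements. *)
Lemma mrankE m i :
  mrank m i = #|[set l | m i < m l]| + #|[set l : 'I_n | (m l == m i) && (l < i)]|.
Proof.
rewrite -cardsUI [X in _ + X]eq_card0 ?addn0 => [|l]; last by rewrite !inE; lia.
by apply: eq_card => l; rewrite !inE /before.
Qed.

Lemma card_gt_mpart m v : #|[set l | v < m l]| = count (ltn v) (mpart m).
Proof.
by rewrite (seq.permP (perm_mpart m)) count_map -sum1_count big_enum_cond -sum1dep_card.
Qed.

(** Unlike multiplication by a fixed monomial, [up k] adds something that depends on its argument.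
    Before the first difference [j] the ranks agree; at [j] the larger exponent has the smaller rank
    or the same, so it is raised whenever the other is. *)
Lemma lt_up k m1 m2 : k < n -> mpart m1 = mpart m2 -> (m1 < m2)%O -> (up k m1 < up k m2)%O.
Proof.
move=> lt_k eq_part.
have eq_deg : mdeg m1 = mdeg m2 by rewrite -!mpart_sumn eq_part.
have eq_deg' : mdeg (up k m1) = mdeg (up k m2) by rewrite !mdeg_up ?eq_deg.
have eq_gt v : #|[set l | v < m1 l]| = #|[set l | v < m2 l]|.
  by rewrite !card_gt_mpart eq_part.
case/(ltmcP eq_deg)=> j eq_j lt_j; apply/(ltmcP eq_deg'); exists j => [i lt_ij|].
  rewrite !upE !mrankE (eq_j i lt_ij) eq_gt; congr (_ + 2 * (_ + _ <= _)).
  apply: eq_card => l; rewrite !inE; have [lt_li|] := ltnP l i; rewrite ?andbF //.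
  by rewrite eq_j // (ltn_trans lt_li).
have le_rank : mrank m2 j <= mrank m1 j.
  apply: (@leq_trans #|[set l | m1 j < m2 l]|); last by rewrite -eq_gt mrankE leq_addr.
  by apply: subset_leq_card; apply/subsetP=> l; rewrite !inE /before; lia.
rewrite !upE; have [le1|] := leqP (mrank m1 j) k; last by lia.
by rewrite (leq_trans le_rank le1); lia.
Qed.

(* Dominance of the sorted exponents, refined by the lexicographic order. *)
Definition prec m1 m2 : Prop := dominated (mpart m1) (mpart m2) /\
  (mpart m1 = mpart m2 -> (m1 < m2)%O).

Lemma prec_trans m2 m1 m3 : prec m1 m2 -> prec m2 m3 -> prec m1 m3.
Proof.
move=> [dom12 lt12] [dom23 lt23]; split=> [|eq13]; first exact: dominated_trans dom23.
have eq12 : mpart m1 = mpart m2.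
  by apply: dominated_anti; rewrite ?size_mpart // eq13.
by apply: (Order.POrderTheory.lt_trans (lt12 eq12)); apply: lt23; rewrite -eq12.
Qed.

Lemma prec_up k m1 m2 : k < n -> prec m1 m2 -> prec (up k m1) (up k m2).
Proof.
move=> lt_k [dom lt]; split=> [|eq_up]; first exact: dominated_up.
have eq_part : mpart m1 = mpart m2.
  by apply: (@addk_inj k); rewrite ?size_mpart -?mpart_up.
by apply: lt_up => //; apply: lt.
Qed.

Lemma prec_dbl k m h : k < n -> #|h| = k.+1 -> h != top m k ->
  prec (m + dbl h)%MM (up k m).
Proof.
move=> lt_k card_h ne_h; split; first exact: dominated_dbl.
exact: lt_dbl.
Qed.

End Dominance.

Local Open Scope ring_scope.

(** * A basis of the polynomials adapted to the ideal *)

Section Support.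

Variable n : nat.
Implicit Types (K : 'X_{1..n} -> Prop) (p q : {mpoly rat[n]}).

Definition supp_in K p : Prop := forall m, m \in msupp p -> K m.

Lemma supp_in0 K : supp_in K 0.
Proof. by move=> m; rewrite msupp0. Qed.

Lemma supp_inD K p q : supp_in K p -> supp_in K q -> supp_in K (p + q).
Proof. by move=> Kp Kq m /msuppD_le; rewrite mem_cat => /orP[/Kp|/Kq]. Qed.

Lemma supp_inZ K a p : supp_in K p -> supp_in K (a *: p).
Proof. by move=> Kp m /msuppZ_le /Kp. Qed.

Lemma supp_inX K m : K m -> supp_in K 'X_[m].
Proof. by move=> Km m'; rewrite msuppX inE => /eqP->. Qed.

Lemma supp_in_sum (I : eqType) (r : seq I) (P : pred I) (F : I -> {mpoly rat[n]}) K :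
  (forall i, i \in r -> P i -> supp_in K (F i)) -> supp_in K (\sum_(i <- r | P i) F i).
Proof.
move=> KF; rewrite big_seq_cond; elim/big_ind: _ => [|p q|i /andP[]].
- exact: supp_in0.
- exact: supp_inD.
- exact: KF.
Qed.

Lemma supp_inS K K' p : (forall m, K m -> K' m) -> supp_in K p -> supp_in K' p.
Proof. by move=> KK' Kp m /Kp/KK'. Qed.

Variable f : 'X_{1..n} -> {mpoly rat[n]}.

Definition lin p : {mpoly rat[n]} := locked (\sum_(m <- msupp p) p@_m *: f m).

(** Padding with zero coefficients puts several polynomials over one index list, as linearity
    requires. *)
Lemma linE p (r : seq 'X_{1..n}) :
  uniq r -> {subset msupp p <= r} -> lin p = \sum_(m <- r) p@_m *: f m.
Proof.
move=> Ur sub_r; rewrite /lin -lock [RHS](bigID (mem (msupp p))) /= [X in _ + X]big1 ?addr0.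
  rewrite -[RHS]big_filter; apply: perm_big; apply: uniq_perm; rewrite ?filter_uniq //.
  by move=> m; rewrite mem_filter; case: (boolP (m \in msupp p)) => //= /sub_r->.
by move=> m /memN_msupp_eq0->; rewrite scale0r.
Qed.

Lemma lin_is_linear : linear lin.
Proof.
move=> a p q; pose r := undup (msupp p ++ msupp q ++ msupp (a *: p + q)).
have sub_r s : {subset s <= msupp p ++ msupp q ++ msupp (a *: p + q)} -> {subset s <= r}.
  by move=> sub m; rewrite mem_undup => /sub.
rewrite !(@linE _ r) ?undup_uniq //;
  try by apply: sub_r => m; rewrite !mem_cat => ->; rewrite ?orbT.
rewrite scaler_sumr -big_split; apply: eq_bigr => m _ /=.
by rewrite mcoeffD mcoeffZ scalerDl scalerA.
Qed.

HB.instance Definition _ :=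
  GRing.isLinear.Build rat {mpoly rat[n]} {mpoly rat[n]} *:%R lin lin_is_linear.

Lemma linX m : lin 'X_[m] = f m.
Proof. by rewrite /lin -lock msuppX big_seq1 mcoeffX eqxx scale1r. Qed.

End Support.

Lemma eq_linear_mpoly n (V : lmodType rat) (f g : {linear {mpoly rat[n]} -> V}) :
  (forall m, f 'X_[m] = g 'X_[m]) -> f =1 g.
Proof.
move=> eq_fg p; rewrite [p]mpolyE !linear_sum; apply: eq_bigr => m _.
by rewrite !linearZ /= eq_fg.
Qed.

Section AdaptedBasis.

Variable n : nat.
Implicit Types (m : 'X_{1..n}) (p q : {mpoly rat[n]}) (k : 'I_n).

Definition esq (k : nat) : {mpoly rat[n]} :=
  \sum_(h : {set 'I_n} | #|h| == k.+1) 'X_[dbl h].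

Definition base m : 'X_{1..n} :=
  [multinom (m i - \sum_(k < n) 2 * (red m k * (mrank m i <= k)))%N | i < n].

Lemma baseE m i :
  base m i = (m i - \sum_(k < n) 2 * (red m k * (mrank m i <= k)))%N.
Proof. exact: mnmE. Qed.

(* Writing [m] as iterates of the [up k] applied to [base m], each [up k] is
   replaced with the multiplication by the elementary symmetric polynomial whose
   leading term it is; for reduced [m] one recovers the descent basis of the
   coinvariant algebra. *)
Definition abasis m : {mpoly rat[n]} := 'X_[base m] * \prod_(k < n) esq k ^+ red m k.

(** All later facts about [abasis] come from this recursion and from its value on reduced
    monomials. *)
Lemma abasis_up k m : abasis (up k m) = esq k * abasis m.
Proof.
have eq_base : base (up k m) = base m.
  apply/mnmP=> i; rewrite !baseE mrank_up -[m i in RHS](addnK (2 * (mrank m i <= k))%N).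
  rewrite -subnDA upE; congr (_ - _)%N.
  rewrite (bigD1 k) //= [in RHS](bigD1 k) //= red_up // eqxx.
  rewrite [in RHS]addnA; congr (_ + _)%N; first by lia.
  apply: eq_bigr => l ne_lk; rewrite red_up // ?mrank_up.
  by rewrite (negPf (_ : l != k :> nat)) ?addn0 //; apply: contraNneq ne_lk => /val_inj->.
rewrite /abasis eq_base mulrCA; congr (_ * _).
rewrite (bigD1 k) //= [in RHS](bigD1 k) //= red_up // eqxx addn1 exprS -mulrA.
congr (_ * (_ * _)); apply: eq_bigr => l ne_lk; rewrite red_up //.
by rewrite (negPf (_ : l != k :> nat)) ?addn0 //; apply: contraNneq ne_lk => /val_inj->.
Qed.

Definition reduced m : bool := [forall k : 'I_n, red m k == 0%N].

Lemma abasis_reduced m : reduced m -> abasis m = 'X_[m].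
Proof.
move/forallP=> red_m; rewrite /abasis big1 ?mulr1 => [|k _]; last by rewrite (eqP (red_m k)).
congr 'X_[_]; apply/mnmP=> i; rewrite baseE big1 ?subn0 // => k _.
by rewrite (eqP (red_m k)).
Qed.

Lemma reducedPn m : ~~ reduced m -> exists k m', m = up k m'.
Proof.
rewrite negb_forall => /existsP[k]; rewrite -lt0n => red_k.
by exists k; apply: red_gt0 red_k.
Qed.

Lemma esqX k m : esq k * 'X_[m] = \sum_(h : {set 'I_n} | #|h| == k.+1) 'X_[(m + dbl h)%MM].
Proof. by rewrite mulr_suml; apply: eq_bigr => h _; rewrite -mpolyXD addmC. Qed.

(** Since [up k] preserves [prec], the terms coming from a monomial below [m] stay below [up k m],
    even those that are leading for it. *)
Lemma supp_esqM k m p : supp_in (fun m' => prec m' m) (p - 'X_[m]) ->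
  supp_in (fun m' => prec m' (up k m)) (esq k * p - 'X_[up k m]).
Proof.
move=> lt_p; have -> : esq k * p - 'X_[up k m] =
    (esq k * 'X_[m] - 'X_[up k m]) + esq k * (p - 'X_[m]) by ring.
apply: supp_inD.
  rewrite esqX (bigD1 (top m k)) ?card_top //= addrAC subrr add0r.
  apply: supp_in_sum => h _ /andP[/eqP card_h ne_h]; apply: supp_inX.
  exact: prec_dbl.
rewrite [p - _]mpolyE mulr_sumr; apply: supp_in_sum => m1 /lt_p lt_m1 _.
rewrite -scalerAr; apply: supp_inZ; rewrite esqX; apply: supp_in_sum => h _ /eqP card_h.
apply: supp_inX; have lt_up1 : prec (up k m1) (up k m) by apply: prec_up.
have [->|ne_h] := eqVneq h (top m1 k); first exact: lt_up1.
by apply: prec_trans lt_up1; apply: prec_dbl.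
Qed.

Lemma abasis_lead m : supp_in (fun m' => prec m' m) (abasis m - 'X_[m]).
Proof.
have [d] := ubnP (mdeg m); elim: d m => // d IHd m; rewrite ltnS => le_d.
have [/abasis_reduced->|/reducedPn[k [m' def_m]]] := boolP (reduced m).
  by rewrite subrr; apply: supp_in0.
rewrite def_m abasis_up; apply/supp_esqM/IHd.
by move: le_d; rewrite def_m mdeg_up //; lia.
Qed.

Lemma msupp_abasis m m' : m' \in msupp (abasis m - 'X_[m]) -> prec m' m.
Proof. exact: abasis_lead. Qed.

(** A numerical height for a partial order: it grows under strict dominance, and when it is constant
    all partial sums agree and the well-founded monomial order takes over. Lengths up to [n]
    suffice, sorted exponents having size [n]. *)
Definition prec_height m := \sum_(j < n.+1) sumn (take j (mpart m)).

Lemma prec_heightP m' m : prec m' m ->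
  (prec_height m' < prec_height m)%N \/ prec_height m' = prec_height m /\ (m' < m)%O.
Proof.
case=> [[eq_s dom] lt].
have := leqif_sum (P := xpredT) (fun (j : 'I_n.+1) _ => leqif_eq (dom j)).
rewrite -![\sum_(_ | _) _]/(prec_height _) => -[]; rewrite leq_eqVlt.
case/orP=> [/eqP eq_h|]; last by left.
rewrite eq_h eqxx => /esym/forallP eq_j; right; split=> //; apply: lt.
have eq_take j : sumn (take j (mpart m')) = sumn (take j (mpart m)).
  have [lt_j|ge_j] := ltnP j n.+1; first exact/eqP/(eq_j (Ordinal lt_j)).
  by rewrite !take_oversize // size_mpart ltnW.
by apply: dominated_anti; rewrite ?size_mpart //; split=> // j; rewrite eq_take.
Qed.

Lemma prec_ind (P : 'X_{1..n} -> Prop) :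
  (forall m, (forall m', prec m' m -> P m') -> P m) -> forall m, P m.
Proof.
move=> IH m; have [d] := ubnP (prec_height m); elim: d m => // d IHd.
move=> m; elim/(@ltmwf n): m => m IHm; rewrite ltnS => le_d.
apply: IH => m' /prec_heightP[lt_h|[eq_h lt_m]].
  by apply: IHd; apply: leq_trans le_d.
by apply: IHm => //; rewrite eq_h ltnS.
Qed.

Lemma prec_irr m : ~ prec m m.
Proof. by case=> _ /(_ erefl); rewrite Order.POrderTheory.ltxx. Qed.

Lemma prec_max (s : seq 'X_{1..n}) :
  s != [::] -> exists2 m, m \in s & forall m', m' \in s -> ~ prec m m'.
Proof.
elim: s => // x s IHs _; have [->|/IHs[m sm max_m]] := eqVneq s [::].
  by exists x; rewrite ?inE // => m'; rewrite inE => /eqP->; apply: prec_irr.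
have [lt_mx|nlt_mx] := pselect (prec m x); [exists x|exists m]; rewrite ?inE ?eqxx ?sm ?orbT //.
  move=> m' /predU1P[->|sm'] lt_x; first exact: (prec_irr lt_x).
  exact: max_m sm' (prec_trans lt_mx lt_x).
by move=> m' /predU1P[->|/max_m].
Qed.

Definition Phi : {linear {mpoly rat[n]} -> {mpoly rat[n]}} := lin abasis.

Lemma PhiX m : Phi 'X_[m] = abasis m.
Proof. exact: linX. Qed.

(** Triangular inversion along [prec]. The control of the support by dominance is what makes the
    inverse [Psi] respect the filtration. *)
Lemma abasis_expand m : exists q, Phi q = 'X_[m] /\
  supp_in (fun m' => dominated (mpart m') (mpart m)) q.
Proof.
elim/prec_ind: m => m IH.
have /boolp.choice[Q QP] : forall m', exists q, prec m' m -> Phi q = 'X_[m'] /\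
    supp_in (fun m'' => dominated (mpart m'') (mpart m')) q.
  move=> m'; have [/IH[q qP]|np] := pselect (prec m' m); first by exists q.
  by exists 0.
exists ('X_[m] - \sum_(m' <- msupp (abasis m - 'X_[m])) (abasis m - 'X_[m])@_m' *: Q m').
split.
  have eq_Q m' : m' \in msupp (abasis m - 'X_[m]) -> Phi ((abasis m - 'X_[m])@_m' *: Q m') =
      (abasis m - 'X_[m])@_m' *: 'X_[m'].
    by move/msupp_abasis => lt_m'; rewrite linearZ (proj1 (QP _ lt_m')).
  by rewrite linearB PhiX linear_sum (eq_big_seq _ eq_Q) -mpolyE opprB addrC subrK.
apply: supp_inD; first by apply: supp_inX; apply: dominated_refl.
rewrite -scaleN1r; apply: supp_inZ; apply: supp_in_sum => m' /msupp_abasis lt_m' _.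
apply: supp_inZ; apply: supp_inS (proj2 (QP _ lt_m')) => m'' dom.
exact: dominated_trans (proj1 lt_m').
Qed.

Definition Psi : {linear {mpoly rat[n]} -> {mpoly rat[n]}} :=
  lin (fun m => projT1 (cid (abasis_expand m))).

Lemma PsiK : cancel Psi Phi.
Proof.
apply: (eq_linear_mpoly (f := Phi \o Psi) (g := idfun)) => m /=.
by rewrite /Psi linX; case: cid => q [].
Qed.

(** A [prec]-maximal monomial of [q] keeps its coefficient: the other basis elements involved have
    all their lower terms strictly below their own index. *)
Lemma Phi_inj : injective Phi.
Proof.
apply: raddf_inj => q Phi_q; apply/eqP/negPn/negP; rewrite -msupp_eq0.
case/prec_max => m qm max_m; move/(congr1 (mcoeff m)): Phi_q.
rewrite mcoeff0 /Phi /= /lin -lock raddf_sum /= (big_rem m) //= mcoeffZ big_seq big1 => [|m' qm'].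
  have -> : (abasis m)@_m = 1.
    rewrite -[abasis m](subrK 'X_[m]) mcoeffD mcoeffX eqxx memN_msupp_eq0 ?add0r //.
    by apply/negP=> /msupp_abasis/prec_irr.
  by rewrite mulr1 addr0 => /eqP; rewrite mcoeff_eq0 qm.
rewrite mcoeffZ; have := qm'; rewrite mem_rem_uniq ?msupp_uniq // inE => /andP[ne_m' sm'].
rewrite -[abasis m'](subrK 'X_[m']) mcoeffD mcoeffX (negPf ne_m') addr0.
rewrite [X in _ * X]memN_msupp_eq0 ?mulr0 //; apply/negP=> /msupp_abasis.
exact: max_m.
Qed.

Lemma PhiK : cancel Phi Psi.
Proof. by move=> q; apply: Phi_inj; rewrite PsiK. Qed.

Lemma supp_Psi (K : 'X_{1..n} -> Prop) p :
  (forall m m', K m -> dominated (mpart m') (mpart m) -> K m') ->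
  supp_in K p -> supp_in K (Psi p).
Proof.
move=> downK Kp; rewrite /Psi /= /lin -lock; apply: supp_in_sum => m /Kp Km _; apply: supp_inZ.
by case: cid => q /= [_]; apply: supp_inS => m'; apply: downK.
Qed.

(** In adapted coordinates, multiplication by [esq k] is a mere shift of indices, injective and with
    no reduced index in its image. *)
Lemma Psi_esq k p : Psi (esq k * p) = lin (fun m => 'X_[up k m]) (Psi p).
Proof.
apply: Phi_inj; rewrite PsiK -{1}[p]PsiK.
elim/mpolyind: (Psi p) => [|c m q _ _ IH]; first by rewrite !linear0 mulr0.
rewrite !linearP mulrDr IH; congr (_ + _).
by rewrite /= !linX -scalerAr abasis_up.
Qed.

Lemma coef_Psi_esq k p m : (Psi (esq k * p))@_(up k m) = (Psi p)@_m.
Proof.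
rewrite Psi_esq; elim/mpolyind: (Psi p) => [|c m' q _ _ IH].
  by rewrite linear0 !mcoeff0.
rewrite linearP /= !mcoeffD !mcoeffZ IH linX !mcoeffX.
by rewrite (inj_eq (@up_inj n k)).
Qed.

Lemma reduced_up k m : reduced (up k m) = false.
Proof. by apply/forallP=> /(_ k); rewrite red_up // eqxx addn1. Qed.

Lemma coef_Psi_esq_reduced k p m : reduced m -> (Psi (esq k * p))@_m = 0.
Proof.
move=> red_m; rewrite Psi_esq; elim/mpolyind: (Psi p) => [|c m' q _ _ IH].
  by rewrite linear0 mcoeff0.
rewrite linearP /= mcoeffD mcoeffZ IH linX mcoeffX addr0.
by case: eqP => [eq_m|]; rewrite ?mulr0 //; rewrite -eq_m reduced_up in red_m.
Qed.

Lemma esq_mesym (k : nat) : esq k = mesym n rat k.+1 \mPo [tuple 'X_i ^+ 2 | i < n].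
Proof.
rewrite mesymE linear_sum; apply: eq_bigr => h _ /=.
rewrite comp_mpolyX mpolyXE_id; apply: eq_bigr => i _.
by rewrite tnth_mktuple !mnmE exprM.
Qed.

Lemma esq0 (k : nat) : (esq k)@_0%MM = 0.
Proof.
rewrite raddf_sum /= big1 // => h /eqP card_h; rewrite mcoeffX.
by rewrite -mdeg_eq0 mdeg_dbl card_h.
Qed.

Lemma inIB_esq (k : nat) p : inIB (esq k * p).
Proof.
rewrite mulrC; exists 1%N, (fun=> p), (fun=> esq k); rewrite big_ord1; split=> // _.
split; first exact: esq0.
exists (mesym n rat k.+1); first exact: mesym_sym.
exact: esq_mesym.
Qed.

Lemma inIB_abasis m : ~~ reduced m -> inIB (abasis m).
Proof. by case/reducedPn=> k [m' ->]; rewrite abasis_up; apply: inIB_esq. Qed.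

(** With [inIB_abasis], this makes the ideal the span of the non-reduced basis elements. By the
    fundamental theorem, a generator is a polynomial in the [esq k] without constant term, and
    multiples of [esq k] only have shifted indices. *)
Lemma coef_Psi_IB p m : inIB p -> reduced m -> (Psi p)@_m = 0.
Proof.
case=> l [a [g [gP ->]]] red_m; rewrite linear_sum raddf_sum big1 // => i _ /=.
have [g0 [h /sym_fundamental[t [def_h _]] def_g]] := gP i.
have {def_h}def_g : g i = \sum_(m' <- msupp t) t@_m' *: \prod_(k < n) esq k ^+ m' k.
  rewrite def_g -def_h [t \mPo _]comp_mpolyEX linear_sum; apply: eq_bigr => m' _.
  rewrite linearZ /= comp_mpolyX rmorph_prod; congr (_ *: _); apply: eq_bigr => k _.
  by rewrite rmorphXn /= tnth_mktuple esq_mesym.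
have prodE m' : m' != 0%MM ->
    exists k : 'I_n, exists q, \prod_(k < n) esq k ^+ m' k = esq k * q.
  move=> nz_m'; have [k nz_k] : exists k : 'I_n, m' k != 0%N.
    apply/existsP; apply: contraNT nz_m'; rewrite negb_exists => /forallP z_m'.
    by apply/eqP/mnmP=> k; rewrite mnm0E; apply/eqP/negPn/z_m'.
  exists k; rewrite (bigD1 k) //=; case: (m' k) nz_k => // e _.
  by rewrite exprS -mulrA; eexists.
(* Nonempty products of the [esq k] have no constant term, so the constant term of the generator is
   that of [t]. *)
have t0 : t@_0%MM = 0.
  have := g0; rewrite def_g raddf_sum /=.
  have [t0|] := boolP (0%MM \in msupp t); last by move/memN_msupp_eq0.
  rewrite (big_rem 0%MM) //= [X in _ + X]big_seq [X in _ + X]big1 => [|m']; last first.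
    rewrite mem_rem_uniq ?msupp_uniq // inE => /andP[/prodE[k [q ->]] _].
    by rewrite mcoeffZ rmorphM /= esq0 mul0r mulr0.
  by rewrite addr0 mcoeffZ big1 ?mcoeff1 ?eqxx ?mulr1 // => k _; rewrite mnm0E.
rewrite def_g mulr_sumr linear_sum raddf_sum big_seq big1 // => m' tm' /=.
have /prodE[k [q ->]] : m' != 0%MM.
  by apply: contraTneq tm' => ->; rewrite mcoeff_msupp t0 eqxx.
by rewrite -scalerAr mulrCA linearZ mcoeffZ coef_Psi_esq_reduced ?mulr0.
Qed.

End AdaptedBasis.

Arguments Phi {n}.
Arguments Psi {n}.

(** * Traces on quotients *)

Section QuotientTrace.

Variables (F : fieldType) (V : lmodType F) (U W : V -> Prop) (phi : V -> V).

(* The images of [e k], for [k] in [s], form a basis of [U / W]. *)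
Definition qbasis (K : eqType) (s : seq K) (e : K -> V) : Prop :=
  [/\ forall k, k \in s -> U (e k),
      forall u, U u -> exists c : K -> F, W (u - \sum_(k <- s) c k *: e k)
    & forall a : K -> F, W (\sum_(k <- s) a k *: e k) -> {in s, forall k, a k = 0}].

Hypothesis W0 : W 0.
Hypothesis WD : forall u v, W u -> W v -> W (u + v).
Hypothesis WZ : forall a u, W u -> W (a *: u).
Hypothesis phiP : linear phi.
Hypothesis phiW : forall u, W u -> W (phi u).

Let WN u : W u -> W (- u).
Proof. by move=> Wu; rewrite -scaleN1r; apply: WZ. Qed.

Let Wtrans v u w : W (u - v) -> W (v - w) -> W (u - w).
Proof. by move=> Wuv Wvw; rewrite -[u](subrK v) -addrA; apply: WD. Qed.

Let Wsym u v : W (u - v) -> W (v - u).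
Proof. by move/WN; rewrite opprB. Qed.

Let Wsum (K : eqType) (s : seq K) (c : K -> F) (x y : K -> V) :
  (forall k, k \in s -> W (x k - y k)) ->
  W (\sum_(k <- s) c k *: x k - \sum_(k <- s) c k *: y k).
Proof.
move=> Wxy; rewrite -sumrB big_seq; elim/big_ind: _ => // k sk.
by rewrite -scalerBr; apply/WZ/Wxy.
Qed.

Let sum_sum (K L : eqType) (s : seq K) (t : seq L) (c : L -> F) (P : L -> K -> F) (e : K -> V) :
  \sum_(l <- t) c l *: (\sum_(k <- s) P l k *: e k) =
  \sum_(k <- s) (\sum_(l <- t) c l * P l k) *: e k.
Proof.
under eq_bigr do rewrite scaler_sumr; rewrite exchange_big /=; apply: eq_bigr => k _.
by rewrite scaler_suml; apply: eq_bigr => l _; rewrite scalerA.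
Qed.

Let qbasis_eq (K : eqType) (s : seq K) (e : K -> V) (a b : K -> F) : qbasis s e ->
  W (\sum_(k <- s) a k *: e k - \sum_(k <- s) b k *: e k) -> {in s, a =1 b}.
Proof.
case=> _ _ free_e Wab k sk; apply/eqP; rewrite -subr_eq0; apply/eqP.
apply: (free_e (fun k => a k - b k)) => //.
by under eq_bigr do rewrite scalerBl; rewrite sumrB.
Qed.

Let sum_delta (K : eqType) (s : seq K) (G : K -> F) k : uniq s -> k \in s ->
  \sum_(l <- s) G l * (l == k)%:R = G k.
Proof.
move=> Us sk; rewrite (bigD1_seq k) //= eqxx mulr1 big1 ?addr0 // => l ne_lk.
by rewrite (negPf ne_lk) mulr0.
Qed.

Let sum_deltaZ (K : eqType) (s : seq K) (e : K -> V) k : uniq s -> k \in s ->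
  \sum_(l <- s) (l == k)%:R *: e l = e k.
Proof.
move=> Us sk; rewrite (bigD1_seq k) //= eqxx scale1r big1 ?addr0 // => l ne_lk.
by rewrite (negPf ne_lk) scale0r.
Qed.

Let phi_sum (K : eqType) (s : seq K) (c : K -> F) (x : K -> V) :
  phi (\sum_(k <- s) c k *: x k) = \sum_(k <- s) c k *: phi (x k).
Proof.
pose phi' := HB.pack_for {linear V -> V} phi (GRing.isLinear.Build _ _ _ _ phi phiP).
rewrite -[phi]/(phi' : V -> V) linear_sum.
by apply: eq_bigr => k _; rewrite linearZ.
Qed.

Let phi_congr u v : W (u - v) -> W (phi u - phi v).
Proof.
move/phiW; congr W; have := phiP (-1) v u.
by rewrite !scaleN1r ![- _ + _]addrC.
Qed.

Let change (K L : eqType) (s : seq K) (t : seq L) (e : K -> V) (f : L -> V)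
    (Q : K -> L -> F) (P : L -> K -> F) : uniq s -> qbasis s e ->
  (forall k, k \in s -> W (e k - \sum_(l <- t) Q k l *: f l)) ->
  (forall l, l \in t -> W (f l - \sum_(k <- s) P l k *: e k)) ->
  {in s &, forall k k', \sum_(l <- t) Q k l * P l k' = (k' == k)%:R}.
Proof.
move=> Us es QP PP k k' sk sk'; apply: (qbasis_eq (a := fun k' => \sum_(l <- t) Q k l * P l k')
  (b := fun k' => (k' == k)%:R) es) => //.
rewrite -sum_sum (sum_deltaZ e) //; apply: Wsym.
by apply: (Wtrans (QP k sk)); apply: Wsum.
Qed.

(** With changes of coordinates [Q] and [P], one has A = QCP and PQ = 1, whence equal traces.
    Arbitrary index types allow ordinals, as in [affords], to be compared with monomials. *)
Lemma qbasis_trace (K L : eqType) (s : seq K) (t : seq L) (e : K -> V) (f : L -> V)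
    (A : K -> K -> F) (C : L -> L -> F) :
  uniq s -> uniq t -> qbasis s e -> qbasis t f ->
  (forall k, k \in s -> W (phi (e k) - \sum_(k' <- s) A k k' *: e k')) ->
  (forall l, l \in t -> W (phi (f l) - \sum_(l' <- t) C l l' *: f l')) ->
  \sum_(k <- s) A k k = \sum_(l <- t) C l l.
Proof.
move=> Us Ut es ft AP CP; have [Ue gen_e _] := es; have [Uf gen_f _] := ft.
have /boolp.choice[Q QP] : forall k, exists c : L -> F,
    k \in s -> W (e k - \sum_(l <- t) c l *: f l).
  move=> k; have [/Ue/gen_f[c Wc]|nsk] := boolP (k \in s); first by exists c.
  by exists (fun=> 0).
have /boolp.choice[P PP] : forall l, exists c : K -> F,
    l \in t -> W (f l - \sum_(k <- s) c k *: e k).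
  move=> l; have [/Uf/gen_e[c Wc]|ntl] := boolP (l \in t); first by exists c.
  by exists (fun=> 0).
have AE k k' : k \in s -> k' \in s ->
    A k k' = \sum_(l' <- t) (\sum_(l <- t) Q k l * C l l') * P l' k'.
  move=> sk sk'; apply: (qbasis_eq (a := A k)
    (b := fun k' => \sum_(l' <- t) (\sum_(l <- t) Q k l * C l l') * P l' k') es) => //.
  apply: (Wtrans (Wsym (AP k sk))).
  have W1 : W (phi (e k) - \sum_(l <- t) Q k l *: phi (f l)).
    by rewrite -phi_sum; apply/phi_congr/QP.
  apply: (Wtrans W1); apply: (Wtrans (Wsum (Q k) CP)); rewrite sum_sum -[X in W (_ - X)]sum_sum.
  exact: Wsum.
rewrite (eq_big_seq _ (fun k sk => AE k k sk sk)) exchange_big /= big_seq [RHS]big_seq.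
apply: eq_bigr => l' tl'; rewrite -[RHS](sum_delta (s := t) (fun l => C l l')) //.
under eq_bigr do rewrite mulr_suml; rewrite exchange_big /= big_seq [RHS]big_seq.
apply: eq_bigr => l tl; rewrite -(change Ut ft PP QP tl' tl) mulr_sumr.
by apply: eq_bigr => k _; ring.
Qed.

End QuotientTrace.

(** * Traces on the subquotients attached to an exponent sequence *)

Section Traces.

Variable n : nat.
Implicit Types (m : 'X_{1..n}) (p q : {mpoly rat[n]}) (k : 'I_n) (la : seq nat).

Definition monomials la : seq 'X_{1..n} :=
  [seq m <- [seq bmnm b | b <- enum {: 'X_{1..n < (sumn la).+1}}] | mpart m == la].

Lemma monomials_uniq la : uniq (monomials la).
Proof. by rewrite filter_uniq // map_inj_uniq ?enum_uniq //; apply: val_inj. Qed.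

Lemma mem_monomials la m : (m \in monomials la) = (mpart m == la).
Proof.
rewrite mem_filter andb_idr // => /eqP def_la; apply/mapP.
have lt_m : (mdeg m < (sumn la).+1)%N by rewrite -def_la mpart_sumn.
by exists (BMultinom lt_m); rewrite ?mem_enum.
Qed.

Lemma coef_sumX (t : seq 'X_{1..n}) (c : 'X_{1..n} -> rat) m : uniq t ->
  (\sum_(m' <- t) c m' *: 'X_[m'])@_m = c m *+ (m \in t).
Proof.
move=> Ut; rewrite raddf_sum /=; have [tm|ntm] := boolP (m \in t).
  rewrite (bigD1_seq m) //= mcoeffZ mcoeffX eqxx mulr1 big1 ?addr0 // => m' ne_m'.
  by rewrite mcoeffZ mcoeffX (negPf ne_m') mulr0.
rewrite big_seq big1 // => m' tm'; rewrite mcoeffZ mcoeffX.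
have [eq_m|_] := eqVneq m' m; last by rewrite mulr0.
by rewrite -eq_m tm' in ntm.
Qed.

Variable la : n.-tuple nat.
Let kle m := dominated (mpart m) la.
Let klt m := dominated (mpart m) la /\ mpart m <> la.

Lemma kle_down m m' : kle m -> dominated (mpart m') (mpart m) -> kle m'.
Proof. by move=> dom dom'; apply: dominated_trans dom. Qed.

Lemma klt_down m m' : klt m -> dominated (mpart m') (mpart m) -> klt m'.
Proof.
move=> [dom ne] dom'; split=> [|eq_m']; first exact: dominated_trans dom.
by case: ne; apply: dominated_anti; rewrite ?size_mpart ?size_tuple // -eq_m'.
Qed.

Lemma kle_klt m : kle m -> m \notin monomials la -> klt m.
Proof. by rewrite mem_monomials => dom /eqP ne. Qed.

Lemma klt_monomials m : klt m -> m \notin monomials la.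
Proof. by rewrite mem_monomials => -[_ /eqP]. Qed.

Lemma kle_monomials m : m \in monomials la -> kle m.
Proof. by rewrite mem_monomials => /eqP; rewrite /kle => ->; apply: dominated_refl. Qed.

Lemma supp_Phi (K : 'X_{1..n} -> Prop) q :
  (forall m m', K m -> dominated (mpart m') (mpart m) -> K m') ->
  supp_in K q -> supp_in K (Phi q).
Proof.
move=> downK Kq; rewrite /Phi /= /lin -lock; apply: supp_in_sum => m /Kq Km _.
apply: supp_inZ; rewrite -[abasis m](subrK 'X_[m]); apply: supp_inD; last exact: supp_inX.
by apply: supp_inS (@abasis_lead _ m) => m' [dom _]; apply: downK dom.
Qed.

Lemma supp_Bact (s : {perm 'I_n * bool}) (K : seq nat -> Prop) p : s \in B n ->
  supp_in (fun m => K (mpart m)) p -> supp_in (fun m => K (mpart m)) (Bact s p).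
Proof.
move=> sB Kp; rewrite [p]mpolyE linear_sum; apply: supp_in_sum => m /Kp Km _ /=.
rewrite linearZ /=; apply: supp_inZ; have [e [t ->]] := BactXm m sB.
apply: supp_inZ; apply: supp_inX.
suff -> : mpart [multinom m (t i) | i < n] = mpart m by [].
apply/perm_sortP; [by move=> x y; apply: leq_total| | |].
- by move=> x y z /= xy yz; apply: leq_trans xy.
- by move=> x y /= /andP[xy yx]; apply/eqP; rewrite eqn_leq xy yx.
by apply/tuple_permP; exists t; congr val; apply: eq_from_tnth => i; rewrite !tnth_mktuple.
Qed.

Lemma monomials_coord p : supp_in kle p ->
  supp_in klt (p - \sum_(m <- monomials la) p@_m *: 'X_[m]).
Proof.
move=> Kp m; rewrite mcoeff_msupp mcoeffB coef_sumX ?monomials_uniq //.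
case: (boolP (m \in _)) => tm; rewrite ?subrr ?eqxx // subr0 -mcoeff_msupp => /Kp km.
exact: kle_klt.
Qed.

Lemma monomials_qbasis :
  qbasis (supp_in kle) (supp_in klt) (monomials la) (fun m => 'X_[m] : {mpoly rat[n]}).
Proof.
have Ut := monomials_uniq la; split=> [m /kle_monomials km|p Kp|a Ka m tm].
- exact: supp_inX.
- by exists (fun m => p@_m); apply: monomials_coord.
- apply/eqP/negPn/negP=> nz; have /klt_monomials : klt m.
    by apply: Ka; rewrite mcoeff_msupp coef_sumX // tm.
  by rewrite tm.
Qed.

Lemma abasis_coord p : supp_in kle p ->
  supp_in klt (p - \sum_(m <- monomials la) (Psi p)@_m *: abasis m).
Proof.
move=> Kp; have -> : p - \sum_(m <- monomials la) (Psi p)@_m *: abasis m =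
    Phi (Psi p - \sum_(m <- monomials la) (Psi p)@_m *: 'X_[m]).
  rewrite [RHS]linearB PsiK; congr (_ - _); rewrite linear_sum; apply: eq_bigr => m _.
  by rewrite linearZ PhiX.
apply: supp_Phi; first exact: klt_down.
move=> m; rewrite mcoeff_msupp mcoeffB coef_sumX ?monomials_uniq //.
case: (boolP (m \in _)) => tm; rewrite ?subrr ?eqxx // subr0 -mcoeff_msupp => Psi_m.
by apply: kle_klt tm; apply: (supp_Psi kle_down Kp).
Qed.

Lemma abasis_qbasis : qbasis (supp_in kle) (supp_in klt) (monomials la) (@abasis n).
Proof.
have Ut := monomials_uniq la; split=> [m /kle_monomials km|p Kp|a Ka m tm].
- by rewrite -PhiX; apply: supp_Phi; [apply: kle_down|apply: supp_inX].
- by exists (fun m => (Psi p)@_m); apply: abasis_coord.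
- apply/eqP/negPn/negP=> nz; have /klt_monomials : klt m.
    have := supp_Psi klt_down Ka; apply; rewrite linear_sum mcoeff_msupp.
    under eq_bigr do rewrite linearZ -PhiX PhiK; rewrite coef_sumX // tm.
    exact: nz.
  by rewrite tm.
Qed.

Variable s : {perm 'I_n * bool}.
Hypothesis sB : s \in B n.

Definition weight m : rat := (Psi (Bact s (abasis m)))@_m.

Lemma Bact_esq (k : nat) : Bact s (esq n k) = esq n k.
Proof.
rewrite esq_mesym; pose a := perm (sabs_inj sB); set h := mesym _ _ _.
have hsym : h \is symmetric by apply: mesym_sym.
rewrite -[h in RHS](issymP _ hsym a) msym_mPo.
rewrite ![h \mPo _]comp_mpolyEX linear_sum; apply: eq_bigr => m _.
rewrite linearZ /= !comp_mpolyX rmorph_prod; congr (_ *: _).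
apply: eq_bigr => j _; rewrite !tnth_mktuple !rmorphXn /= BactX exprZn.
by rewrite sqrr_sign scale1r permE.
Qed.

(** Multiplication by the invariant [esq k] commutes with the action and shifts the adapted basis,
    so it transports diagonal coefficients. *)
Lemma weight_up k m : weight (up k m) = weight m.
Proof. by rewrite /weight abasis_up rmorphM /= Bact_esq coef_Psi_esq. Qed.

Lemma kle_Bact p : supp_in kle p -> supp_in kle (Bact s p).
Proof. by move=> Kp; apply: (supp_Bact (K := fun l => dominated l la)). Qed.

(** Both sides are the trace of [s] on one subquotient of the polynomial ring: the left one is
    accessible to the Frobenius formula, the right one to the steps [up k]. *)
Lemma sum_Bact_monomials : \sum_(m <- monomials la) (Bact s 'X_[m])@_m =
  \sum_(m <- monomials la) weight m.
Proof.
have Ut := monomials_uniq la.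
apply: (qbasis_trace (phi := Bact s) (A := fun m m' => (Bact s 'X_[m])@_m')
  (C := fun m m' => (Psi (Bact s (abasis m)))@_m') _ _ _ _ _ Ut Ut monomials_qbasis abasis_qbasis).
- exact: supp_in0.
- by move=> p q; apply: supp_inD.
- by move=> a p; apply: supp_inZ.
- exact: linearP.
- by move=> p; apply: (supp_Bact (K := fun l => dominated l la /\ l <> la)).
- by move=> m tm; apply: monomials_coord; apply: kle_Bact; case: monomials_qbasis => /(_ m tm).
- by move=> m tm; apply: abasis_coord; apply: kle_Bact; case: abasis_qbasis => /(_ m tm).
Qed.

Let t := [seq m <- monomials la | reduced m].

Let Ut : uniq t.
Proof. by rewrite filter_uniq ?monomials_uniq. Qed.

Lemma psiB_coord p : supp_in kle p ->
  psi_image (P_lt la) (psiB p - \sum_(m <- t) (Psi p)@_m *: psiB 'X_[m]).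
Proof.
(* [G] keeps the reduced monomials only. After [psiB] it agrees with [Phi], since a reduced
   [abasis m] is a monomial and the others lie in the ideal. *)
move=> Kp; pose G := lin (fun m => if reduced m then 'X_[m] else 0 : {mpoly rat[n]}).
have GE q m : (G q)@_m = q@_m *+ reduced m.
  elim/mpolyind: q => [|c m' q _ _ IH]; first by rewrite /G linear0 mcoeff0 mul0rn.
  rewrite /G linearP /= mcoeffD IH mcoeffZ linX mcoeffD mcoeffZ mulrnDl mcoeffX.
  congr (_ + _); case: eqVneq => [<-|ne]; case: (reduced m') => //=;
  by rewrite ?mcoeffX ?eqxx ?(negPf ne) ?mcoeff0 ?mulr0 ?mul0rn.
have psiPhi q : psiB (Phi q) = psiB (G q).
  apply: (eq_linear_mpoly (f := @psiB n \o Phi)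
    (g := @psiB n \o lin (fun m => if reduced m then 'X_[m] else 0))) => m' /=.
  rewrite !linX.
  have [/abasis_reduced->//|nred] := boolP (reduced m').
  by apply/psiB_eq; rewrite subr0; apply: inIB_abasis.
exists (G (Psi p) - \sum_(m <- t) (Psi p)@_m *: 'X_[m]).
  move=> m; rewrite mcoeff_msupp mcoeffB GE coef_sumX //.
  rewrite mem_filter; case: (reduced m); rewrite ?subrr ?eqxx //=.
  case: (boolP (m \in _)) => tm; rewrite ?subrr ?eqxx // subr0 -mcoeff_msupp => Psi_m.
  by apply: kle_klt tm; apply: (supp_Psi kle_down Kp).
have -> : psiB p = psiB (G (Psi p)) by rewrite -psiPhi PsiK.
rewrite linearB; congr (_ - _); rewrite linear_sum; apply: eq_bigr => m _.
by rewrite linearZ.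
Qed.

Lemma psiB_qbasis :
  qbasis (psi_image (P_le la)) (psi_image (P_lt la)) t (fun m => psiB 'X_[m]).
Proof.
split=> [m|u [p Kp <-]|a [p Kp eq_p] m tm].
- rewrite mem_filter => /andP[_ /kle_monomials km].
  by eexists; last by []; apply: supp_inX.
- by exists (fun m => (Psi p)@_m); apply: psiB_coord.
have [red_m tlm] : reduced m /\ m \in monomials la by move: tm; rewrite mem_filter => /andP.
(* The relation lifts to the ideal, whose adapted coordinates vanish at reduced [m]; those of [p]
   vanish at [m] as well, [p] being strictly below [la]. *)
have : inIB (p - \sum_(m <- t) a m *: 'X_[m]).
  by apply/psiB_eq; rewrite eq_p linear_sum; apply: eq_bigr => m' _; rewrite linearZ.
move/coef_Psi_IB => /(_ m red_m); rewrite linearB mcoeffB.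
rewrite memN_msupp_eq0; last first.
  by apply: contraL tlm => /(supp_Psi klt_down Kp)/klt_monomials.
have -> : Psi (\sum_(m' <- t) a m' *: 'X_[m']) = \sum_(m' <- t) a m' *: 'X_[m'].
  rewrite linear_sum big_seq [RHS]big_seq; apply: eq_bigr => m'.
  rewrite mem_filter => /andP[red_m' _]; rewrite linearZ; congr (_ *: _).
  by rewrite -[in LHS](abasis_reduced red_m') -PhiX PhiK.
by rewrite coef_sumX // tm sub0r => /eqP; rewrite oppr_eq0 => /eqP.
Qed.

Lemma affords_qbasis (gT : finGroupType) (G : {group gT}) (V : lmodType rat)
    (act : gT -> V -> V) (U W : V -> Prop) d (rG : mx_representation rat G d) :
  W 0 -> U 0 -> affords act U W rG -> exists e : 'I_d -> V,
    qbasis U W (index_enum 'I_d) e /\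
    forall g i, g \in G -> W (act g (e i) - \sum_j rG g i j *: e j).
Proof.
move=> W0 U0 [e [Ue gen_e act_e]]; exists e; split=> //; split=> [//|u Uu|a Wa i _].
  by have [c [Wc _]] := gen_e u Uu; exists (fun i => c 0 i).
(* Independence from uniqueness: the zero row and the opposite of a relation [a] are both
   coordinates of the vector 0 modulo [W]. *)
have [c [_ uniq_c]] := gen_e 0 U0.
have c0 : c = 0.
  by apply: uniq_c; rewrite big1 ?subr0 // => j _; rewrite mxE scale0r.
have ca : c = \row_j - a j.
  apply: uniq_c; under eq_bigr do rewrite mxE scaleNr; by rewrite sumrN opprK add0r.
have := congr1 (fun c : 'rV_d => c 0 i) ca; rewrite c0 !mxE => /eqP.
by rewrite eq_sym oppr_eq0 => /eqP.
Qed.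

Lemma trace_RB : \tr (RB la s) = \sum_(m <- monomials la | reduced m) weight m.
Proof.
have W0 : psi_image (P_lt la) 0 by apply: (@psi_image0 n (fun l => dominated l la /\ l <> la)).
have U0 : psi_image (P_le la) 0 by apply: (@psi_image0 n (fun l => dominated l la)).
have [e [e_basis e_act]] := affords_qbasis W0 U0 (RB_affords la).
rewrite -big_filter -/t.
rewrite (eq_big_seq (fun m => (Psi (Bact s 'X_[m]))@_m)) => [|m]; last first.
  by rewrite mem_filter => /andP[red_m _]; rewrite /weight abasis_reduced.
apply: (qbasis_trace (phi := @Bactq n s) (A := fun i j => RB la s i j)
  (C := fun m m' => (Psi (Bact s 'X_[m]))@_m') 
  _ _ _ _ _ (index_enum_uniq _) Ut e_basis psiB_qbasis).
- exact: W0.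
- exact: (@psi_imageD n (fun l => dominated l la /\ l <> la)).
- exact: (@psi_imageZ n (fun l => dominated l la /\ l <> la)).
- by move=> a u v; rewrite -[u]psiB_repr -[v]psiB_repr -linearP !Bactq_psiB // !linearP.
- by move=> u; apply: (psi_image_act (K := fun l => dominated l la /\ l <> la) sB).
- by move=> i _; apply: e_act.
move=> m; rewrite mem_filter => /andP[_ /kle_monomials km].
rewrite Bactq_psiB //; apply: psiB_coord; apply: kle_Bact.
exact: supp_inX.
Qed.

End Traces.

(** * Inclusion-exclusion on monomials *)

Section WeightSums.

Variables (n : nat) (s : {perm 'I_n * bool}).
Hypothesis sB : s \in B n.
Implicit Types (la : seq nat) (D : {set 'I_n}) (k : 'I_n).

(** Interpolates between the trace on the span of all the monomials, for empty [D], and the trace on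
    R_lambda, for full [D]. *)
Definition weight_sum la D : rat :=
  \sum_(m <- monomials n la | [forall k in D, red m k == 0%N]) weight s m.

Lemma weight_sum0 la : weight_sum la set0 = \sum_(m <- monomials n la) weight s m.
Proof. by apply: eq_bigl => m; apply/forall_inP=> k; rewrite inE. Qed.

Lemma weight_sumT la :
  weight_sum la setT = \sum_(m <- monomials n la | reduced m) weight s m.
Proof.
by apply: eq_bigl => m; apply: eq_forallb => k; rewrite inE.
Qed.

Lemma forall_setU1 D k (P : pred 'I_n) :
  [forall l in k |: D, P l] = [forall l in D, P l] && P k.
Proof.
apply/forall_inP/andP=> [PkD|[/forall_inP PD Pk] l].
  by split; [apply/forall_inP=> l lD|]; apply: PkD; rewrite !inE ?lD ?eqxx ?orbT.
by case/setU1P=> [->//|/PD].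
Qed.

(** The monomials excluded by the condition at [k] form the image of [up k], which preserves weights
    and, as [k] is not in [D], the conditions at [D]. *)
Lemma weight_sum_addk la D k : size la = n -> k \notin D ->
  weight_sum (addk k la) (k |: D) = weight_sum (addk k la) D - weight_sum la D.
Proof.
move=> sz_la nDk; apply/eqP; rewrite eq_sym subr_eq; apply/eqP.
rewrite {1}/weight_sum (bigID (fun m => red m k == 0%N)) /=; congr (_ + _).
  by apply: eq_bigl => m; rewrite forall_setU1.
rewrite -big_filter /weight_sum -[RHS]big_filter.
under [RHS]eq_bigr do rewrite -(weight_up sB k); rewrite -(big_map (up k) xpredT).
have Uf la' (P : pred 'X_{1..n}) : uniq [seq m <- monomials n la' | P m].
  by apply: filter_uniq; apply: monomials_uniq.
apply: perm_big; apply: uniq_perm; rewrite ?(map_inj_uniq (@up_inj n k)) ?Uf //.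
move=> m; rewrite mem_filter mem_monomials; apply/idP/mapP.
  case/andP=> /andP[redD red_k] /eqP part_m.
  have [m' def_m] := red_gt0 (ltn_ord k) (etrans (lt0n _) red_k).
  exists m' => //; rewrite mem_filter mem_monomials.
  move: part_m; rewrite def_m mpart_up => /addk_inj->; rewrite ?size_mpart ?eqxx //.
  rewrite andbT; apply/forall_inP=> l Dl; have /forall_inP/(_ l Dl) := redD.
  by rewrite def_m red_up // addn_eq0 => /andP[].
case=> m'; rewrite mem_filter mem_monomials => /andP[/forall_inP redD /eqP part_m] ->.
rewrite mpart_up part_m eqxx red_up // eqxx addn1 !andbT.
apply/forall_inP=> l Dl; rewrite red_up // (eqP (redD l Dl)).
have [eq_lk|] := eqVneq (val l) (val k); last by [].
by rewrite -(val_inj eq_lk) Dl in nDk.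
Qed.

Lemma weight_sum_gap la D k : (nth 0 la k < nth 0 la k.+1 + 2)%N ->
  weight_sum la (k |: D) = weight_sum la D.
Proof.
move=> lt_gap; rewrite /weight_sum big_seq_cond [RHS]big_seq_cond.
apply: eq_bigl => m; rewrite forall_setU1 mem_monomials.
case: eqP => //= part_m; rewrite andb_idr // => _.
by rewrite /red /gap part_m; lia.
Qed.

End WeightSums.

(** * The Frobenius formula *)

Section CycleExpansion.

Variables (n : nat) (s : {perm 'I_n * bool}) (V : finType) (v0 : V) (R : comNzRingType).
Variable (g : 'I_n -> V -> R).
Hypothesis sB : s \in B n.

Definition cycle_of (i : 'I_n) : {set 'I_n} := [set j | fconnect (sabs s) i j].

Lemma cycle_ofP i j : (j \in cycle_of i) = (cycle_of j == cycle_of i).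
Proof.
have sym : connect_sym (frel (sabs s)) := fconnect_sym (sabs_inj sB).
apply/idP/eqP=> [|<-]; last by rewrite inE connect0.
rewrite inE => conn_ij; apply/setP=> k.
by rewrite !inE -(same_connect sym conn_ij).
Qed.

Lemma mem_cycles C i : C \in cycles s -> (i \in C) = (cycle_of i == C).
Proof. by case/imsetP=> j _ ->; rewrite cycle_ofP. Qed.

Lemma cycle_of_cycles i : cycle_of i \in cycles s.
Proof. exact: imset_f. Qed.

Lemma cycle_of_sabs i : cycle_of (sabs s i) = cycle_of i.
Proof. by apply/eqP; rewrite -cycle_ofP inE fconnect1. Qed.

Definition invariant_fun (f : {ffun 'I_n -> V}) : bool := [forall i, f (sabs s i) == f i].

Lemma invariant_cycle f i j :
  invariant_fun f -> cycle_of i = cycle_of j -> f i = f j.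
Proof.
move=> /forallP inv_f eq_c.
have : j \in cycle_of i by rewrite cycle_ofP eq_c.
rewrite inE => /iter_findex <-; elim: (findex _ _ _) => //= k ->.
by rewrite (eqP (inv_f _)).
Qed.

(** Expanding the product chooses one value per cycle, that is, a function constant on cycles; [v0]
    is the value at sets that are not cycles. *)
Lemma prod_cycles : \prod_(C in cycles s) \sum_v \prod_(i in C) g i v =
  \sum_(f | invariant_fun f) \prod_i g i (f i).
Proof.
rewrite (big_distr_big v0).
have prodE (F : {ffun {set 'I_n} -> V}) :
    \prod_(C in cycles s) \prod_(i in C) g i (F C) = \prod_i g i (F (cycle_of i)).
  rewrite (partition_big cycle_of (mem (cycles s))) => [|i _]; last exact: cycle_of_cycles.
  apply: eq_bigr => C CC; apply: eq_big => [i|i]; rewrite mem_cycles // => /eqP->//.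
under eq_bigr do rewrite prodE.
pose h (f : {ffun 'I_n -> V}) : {ffun {set 'I_n} -> V} :=
  [ffun C => if C \in cycles s then odflt v0 (omap f [pick i in C]) else v0].
pose h' (F : {ffun {set 'I_n} -> V}) : {ffun 'I_n -> V} := [ffun i => F (cycle_of i)].
have pickC i : exists2 j, [pick j in cycle_of i] = Some j & cycle_of j = cycle_of i.
  case: pickP => [j|/(_ i)]; last by rewrite cycle_ofP eqxx.
  by rewrite cycle_ofP => /eqP; exists j.
rewrite (reindex_onto h h') => [|F]; last first.
  move/pfamilyP=> [/supportP supp_F _]; apply/ffunP=> C; rewrite !ffunE.
  case: ifPn => [/imsetP[i _ ->]|nC]; last by rewrite supp_F.
  by have [j -> eq_j] := pickC i; rewrite /= ffunE eq_j.
apply: eq_big => [f|f /andP[_ /eqP eq_f]]; last first.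
  by apply: eq_bigr => i _; rewrite -[in RHS]eq_f [in RHS]ffunE.
apply/andP/idP=> [[_ /eqP<-]|inv_f].
  by apply/forallP=> i; rewrite !ffunE cycle_of_sabs.
split.
  apply/pfamilyP; split=> //; apply/supportP=> C nC.
  by rewrite ffunE (negPf nC).
apply/eqP/ffunP=> i; rewrite !ffunE cycle_of_cycles.
by have [j -> /= eq_j] := pickC i; apply: invariant_cycle.
Qed.

End CycleExpansion.

Section FrobeniusCoefficients.

Variables (n N' : nat).
Local Notation N := N'.+1.
Local Notation V := 'I_(N + N).
Implicit Types (v : V) (la : seq nat).

(* The variable [x_j] stands for the exponent [2 (N' - j)] and [y_j] for
   [2 (N' - j) + 1]: then weakly increasing rows and strictly increasing columns
   of semistandard tableaux become weakly and strictly decreasing exponents. *)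
Definition exponent v : nat :=
  match split v with inl j => 2 * (N' - j) | inr j => 2 * (N' - j) + 1 end.

Lemma exponent_lshift (j : 'I_N) : exponent (lshift N j) = (2 * (N' - j))%N.
Proof. by rewrite /exponent (unsplitK (inl j)). Qed.

Lemma exponent_rshift (j : 'I_N) : exponent (rshift N j) = (2 * (N' - j) + 1)%N.
Proof. by rewrite /exponent (unsplitK (inr j)). Qed.

Lemma exponent_inj : injective exponent.
Proof.
move=> u v; rewrite -[u]splitK -[v]splitK.
case: (split u) => i; case: (split v) => j /=;
  rewrite ?exponent_lshift ?exponent_rshift => eq_ij; try (exfalso; lia).
  by congr lshift; apply: ord_inj; have := ltn_ord i; have := ltn_ord j; lia.
by congr rshift; apply: ord_inj; have := ltn_ord i; have := ltn_ord j; lia.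
Qed.

Lemma exponent_onto e : (e < 2 * N)%N -> exists v, exponent v = e.
Proof.
move=> lt_e; have lt_j : (N' - e./2 < N)%N by lia.
have [odd_e|even_e] := boolP (odd e).
  by exists (rshift N (Ordinal lt_j)); rewrite exponent_rshift /=; lia.
by exists (lshift N (Ordinal lt_j)); rewrite exponent_lshift /=; lia.
Qed.

(** Its coefficient isolates the monomials with sorted exponents [la] on one side of the Frobenius
    formula, and the tableaux of content [la] on the other. *)
Definition content_mnm la : 'X_{1..N + N} := [multinom count_mem (exponent v) la | v < N + N].

Lemma coef_content (I : finType) (f : I -> V) la : all (fun e => e < 2 * N)%N la ->
  (\prod_i 'X_(f i) : {mpoly algC[N + N]})@_(content_mnm la) =
  (perm_eq [seq exponent (f i) | i <- enum I] la)%:R.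
Proof.
move=> /allP lt_la; rewrite mprodXE mcoeffX; congr (nat_of_bool _)%:R.
have countE v : (\sum_i U_(f i))%MM v = count_mem (exponent v) [seq exponent (f i) | i <- enum I].
  rewrite mnm_sumE count_map -sum1_count big_enum_cond /= [RHS]big_mkcond /=.
  by apply: eq_bigr => i _; rewrite mnm1E (inj_eq exponent_inj); case: (_ == _).
apply/eqP/idP=> [eq_m|/seq.permP eq_c]; last first.
  by apply/mnmP=> v; rewrite countE mnmE eq_c.
apply/allP=> e; rewrite mem_cat => e_in.
(* Without the bound on [la], values carried by no variable would be invisible in
   [content_mnm la]. *)
have [v <-] : exists v, exponent v = e.
  case/orP: e_in => [/mapP[i _ ->]|/lt_la/exponent_onto //].
  by exists (f i).
by rewrite /= -countE eq_m mnmE.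
Qed.

Variable s : {perm 'I_n * bool}.
Hypothesis sB : s \in B n.

Definition signed_var (i : 'I_n) v : {mpoly algC[N + N]} :=
  (-1) ^+ (sneg s i && odd (exponent v)) *: 'X_v.

(** Odd exponents belong to the [y] variables, so around a cycle the signs multiply to 1 on [x] and
    to the sign of the cycle on [y]. *)
Lemma frobenius_lhs (x := fun i : 'I_N => 'X_(lshift N i) : {mpoly algC[N + N]})
    (y := fun i : 'I_N => 'X_(rshift N i) : {mpoly algC[N + N]}) :
  \prod_(k <- pos_lengths s) (psum x k + psum y k)
    * \prod_(k <- neg_lengths s) (psum x k - psum y k)
  = \sum_(f : {ffun 'I_n -> V} | invariant_fun s f) \prod_i signed_var i (f i).
Proof.
rewrite -(prod_cycles (lshift N ord0 : V)) //.
have odd_l (j : 'I_N) : odd (exponent (lshift N j)) = false by rewrite exponent_lshift; lia.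
have odd_r (j : 'I_N) : odd (exponent (rshift N j)) = true by rewrite exponent_rshift; lia.
have cycE (C : {set 'I_n}) : \sum_v \prod_(i in C) signed_var i v =
    psum x #|C| + (-1) ^+ neg_cycle s C *: psum y #|C|.
  rewrite big_split_ord /=; congr (_ + _).
    apply: eq_bigr => j _; under eq_bigr do rewrite /signed_var odd_l andbF scale1r.
    by rewrite prodr_const.
  rewrite scaler_sumr; apply: eq_bigr => j _.
  under eq_bigr do rewrite /signed_var odd_r andbT.
  rewrite scaler_prod prodr_const; congr (_ *: _).
  rewrite -expr_sum /neg_cycle signr_odd -sum1_card; congr (_ ^+ _).
  rewrite [RHS]big_mkcond [LHS]big_mkcond; apply: eq_bigr => i _ /=; rewrite inE.
  by case: (i \in C); case: (sneg s i).
under [RHS]eq_bigr do rewrite cycE.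
rewrite [RHS](bigID (neg_cycle s)) /= [RHS]mulrC !big_map !big_enum /=.
congr (_ * _); apply: eq_big => C; rewrite ?inE // => /andP[_].
  by move/negPf->; rewrite scale1r.
by move->; rewrite expr1 scaleN1r.
Qed.

Lemma coef_Bact (m : 'X_{1..n}) : (Bact s 'X_[m])@_m =
  if [forall i, m (sabs s i) == m i] then \prod_i (-1) ^+ (sneg s i && odd (m i)) else 0.
Proof.
pose a := perm (sabs_inj sB).
have -> : Bact s 'X_[m] = (\prod_i (-1) ^+ (sneg s i && odd (m i))) *:
    'X_[[multinom m ((a^-1)%g i) | i < n]].
  rewrite [in RHS]mpolyXE_id [X in _ *: X](reindex_inj (@perm_inj _ a)) /=.
  rewrite /Bact comp_mpolyX -scaler_prod; apply: eq_bigr => i _.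
  rewrite tnth_mktuple mnmE permK exprZn permE; congr (_ *: _).
  by rewrite -exprM; case: (sneg s i); rewrite ?mul0n ?mul1n //= signr_odd.
rewrite mcoeffZ mcoeffX; case: ifP => [/forallP inv_m|/negP ninv_m].
  case: eqP => [_|[]]; first by rewrite mulr1.
  apply/mnmP=> i; have /eqP := inv_m ((a^-1)%g i).
  by rewrite mnmE -(permE (sabs_inj sB)) -/a permKV => ->.
case: eqP => [eq_m|]; last by rewrite mulr0.
case: ninv_m; apply/forallP=> i; apply/eqP.
by rewrite -{1}eq_m mnmE -(permE (sabs_inj sB)) permK.
Qed.

(** A function [f] is read as the monomial with exponents [exponent (f i)]; invariance of [f] under
    |s| means that [s] fixes this monomial up to sign. *)
Lemma coef_frobenius_lhs la : all (fun e => e < 2 * N)%N la -> sorted geq la ->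
  (\sum_(f : {ffun 'I_n -> V} | invariant_fun s f) \prod_i signed_var i (f i))@_(content_mnm la)
  = ratr (\sum_(m <- monomials n la) (Bact s 'X_[m])@_m).
Proof.
move=> lt_la la_sort.
pose mon (f : {ffun 'I_n -> V}) : 'X_{1..n} := [multinom exponent (f i) | i < n].
pose P (f : {ffun 'I_n -> V}) := perm_eq [seq exponent (f i) | i <- enum 'I_n] la.
have part_mon f : (mpart (mon f) == la) = P f.
  have perm_mon : perm_eq (mpart (mon f)) [seq exponent (f i) | i <- enum 'I_n].
    rewrite (permPl (perm_mpart _)) (eq_map (g := fun i => exponent (f i))) => [|i].
      exact: perm_refl.
    by rewrite mnmE.
  apply/eqP/idP=> [part_f|Pf].
    by rewrite /P -part_f perm_sym.
  apply: (@sorted_eq _ geq); rewrite ?sorted_mpart //.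
  - by move=> a b c /= ab bc; apply: leq_trans ab.
  - by move=> a b /= /andP[ab ba]; apply/eqP; rewrite eqn_leq ab ba.
  - exact: perm_trans perm_mon Pf.
have mon_inj : injective mon.
  move=> f1 f2 /mnmP eq_m; apply/ffunP=> i; apply: exponent_inj.
  by have := eq_m i; rewrite !mnmE.
have -> : \sum_(m <- monomials n la) (Bact s 'X_[m])@_m =
    \sum_(f | P f) (Bact s 'X_[mon f])@_(mon f).
  rewrite -[RHS]big_filter -(big_map mon xpredT (fun m => (Bact s 'X_[m])@_m)).
  apply: perm_big; apply: uniq_perm.
  - exact: monomials_uniq.
  - by rewrite (map_inj_uniq mon_inj); apply: filter_uniq; apply: index_enum_uniq.
  move=> m; rewrite mem_monomials; apply/eqP/mapP=> [part_m|[f]]; last first.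
    by rewrite mem_filter -part_mon => /andP[/eqP part_f _] ->.
  have lt_m i : (m i < 2 * N)%N.
    have : m i \in mpart m by rewrite (perm_mem (perm_mpart m)); apply: map_f; rewrite mem_enum.
    by rewrite part_m; move/allP: lt_la; apply.
  have /fin_all_exists[F FE] i : exists v, exponent v = m i by apply: exponent_onto.
  have mon_F : mon [ffun i => F i] = m by apply/mnmP=> i; rewrite mnmE ffunE FE.
  by exists [ffun i => F i]; rewrite ?mem_filter ?mem_index_enum ?andbT -?part_mon mon_F ?part_m.
rewrite !raddf_sum [LHS]big_mkcond [RHS]big_mkcond; apply: eq_bigr => f _ /=.
rewrite scaler_prod mcoeffZ coef_content // -/(P f) coef_Bact.
have -> : [forall i, mon f (sabs s i) == mon f i] = invariant_fun s f.
  by apply: eq_forallb => i; rewrite !mnmE (inj_eq exponent_inj).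
case: (P f); case: (invariant_fun s f); rewrite ?mulr0 ?mulr1 ?rmorph0 //.
rewrite rmorph_prod; apply: eq_bigr => i _.
by rewrite rmorphXn rmorphN1 mnmE.
Qed.

Definition bifun (mu : Defs.shape n * Defs.shape n)
    (T : {ffun box mu.1 -> 'I_N} * {ffun box mu.2 -> 'I_N}) (b : bibox mu) : V :=
  match b with inl b => lshift N (T.1 b) | inr b => rshift N (T.2 b) end.

Definition semistandard_content mu la :
    {set {ffun box mu.1 -> 'I_N} * {ffun box mu.2 -> 'I_N}} :=
  [set T | [&& semistandard T.1, semistandard T.2 &
     perm_eq [seq exponent (@bifun mu T b) | b <- enum {: bibox mu}] la]].

Lemma coef_schur (mu : Defs.shape n * Defs.shape n) la : all (fun e => e < 2 * N)%N la ->
  (schur mu.1 (fun i : 'I_N => 'X_(lshift N i) : {mpoly algC[N + N]})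
   * schur mu.2 (fun i : 'I_N => 'X_(rshift N i)))@_(content_mnm la)
  = #|semistandard_content mu la|%:R.
Proof.
move=> lt_la; rewrite mulr_suml raddf_sum /=.
under eq_bigr do rewrite mulr_sumr raddf_sum /=.
rewrite pair_big /= -sum1_card natr_sum [LHS]big_mkcond [RHS]big_mkcond.
apply: eq_bigr => -[T1 T2] _ /=; rewrite inE /=.
case: (semistandard T1) => //=; case: (semistandard T2) => //=.
have -> : \prod_b 'X_(lshift N (T1 b)) * \prod_b 'X_(rshift N (T2 b)) =
    \prod_(b : bibox mu) 'X_(bifun (T1, T2) b) :> {mpoly algC[N + N]}.
  by rewrite big_sumType.
by rewrite (coef_content (@bifun mu (T1, T2))) //; case: perm_eq.
Qed.

Lemma frobenius_monomials (chi : bipartition n -> Iirr (B n)) la : frobenius chi ->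
  all (fun e => e < 2 * N)%N la -> sorted geq la ->
  ratr (\sum_(m <- monomials n la) (Bact s 'X_[m])@_m) =
  \sum_mu #|semistandard_content (val mu) la|%:R * 'chi_(chi mu) s.
Proof.
move=> frob lt_la la_sort; rewrite -coef_frobenius_lhs // -frobenius_lhs.
have /= -> := frob s N sB; rewrite raddf_sum; apply: eq_bigr => mu _.
by rewrite /= mcoeffZ mulrC coef_schur.
Qed.

End FrobeniusCoefficients.

Local Close Scope ring_scope.

(** * Standardization *)

Lemma semistandardP n (la : Defs.shape n) N (T : {ffun box la -> 'I_N}) :
  reflect (forall b c, box_lt b c ->
             if (val b).1 == (val c).1 then T b <= T c else T b < T c)
          (semistandard T).
Proof.
apply: (iffP forallP) => [ssT b c|ssT b].
  have /forallP/(_ c)/andP[/implyP row_T /implyP col_T] := ssT b.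
  case/orP=> [rT|cT]; first by have /andP[-> _] := rT; apply: row_T.
  have /andP[_ lt_r] := cT; case: eqP => [eq_r|_]; last exact: col_T.
  by rewrite eq_r ltnn in lt_r.
apply/forallP=> c; have := ssT b c; rewrite /box_lt => {}ssT.
apply/andP; split; apply/implyP=> cond.
  by move: ssT; rewrite cond => /(_ isT); have /andP[-> _] := cond.
move: ssT; rewrite cond orbT => /(_ isT).
by have /andP[_ lt_r] := cond; case: eqP => // eq_r; rewrite eq_r ltnn in lt_r.
Qed.

Section Standardization.

Variables (n : nat) (mu : Defs.shape n * Defs.shape n).
Implicit Types (b c : bibox mu) (Q : {ffun bibox mu -> 'I_n}) (la : seq nat).

Definition in_second b : bool := if b is inr _ then true else false.

(** The offset [n] exceeds every row index of the first diagram, so one number encodes diagram and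
    row, and comparisons of boxes become arithmetic. *)
Definition row_key b : nat :=
  match b with inl b => (val b).1 | inr b => n + (val b).1 end.

Definition col_key b : nat :=
  match b with inl b => (val b).2 | inr b => (val b).2 end.

Lemma rows_belowE b c : rows_below b c = (row_key b < row_key c).
Proof.
case: b c => [b|b] [c|c] //=; last by rewrite ltn_add2l.
  by rewrite ltn_addr.
by apply/esym/negbTE; rewrite -leqNgt ltnW // ltn_addr.
Qed.

Lemma box_key_inj b c : row_key b = row_key c -> col_key b = col_key c -> b = c.
Proof.
case: b c => [[[i j] bij]|[[i j] bij]] [[[k l] bkl]|[[k l] bkl]] /= eq_r eq_c.
- by congr inl; apply/val_inj; congr pair; apply: ord_inj.
- by have := ltn_ord i; lia.
- by have := ltn_ord k; lia.
- by congr inr; apply/val_inj; congr pair; apply: ord_inj => //; apply: addnI eq_r.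
Qed.

(* Equal entries occupy a horizontal strip, labelled from left to right, that is,
   from the bottom row to the top row. *)
Definition tie b c : bool :=
  (row_key c < row_key b) || (row_key b == row_key c) && (col_key b < col_key c).

Definition std_lt (E : bibox mu -> nat) b c : bool :=
  (E c < E b) || (E b == E c) && tie b c.

Lemma std_total E : strict_total (std_lt E).
Proof.
split=> [b | b a c | b c ne_bc]; rewrite /std_lt /tie; try by lia.
have : ~ (row_key b = row_key c /\ col_key b = col_key c).
  by case=> eq_r eq_c; move: ne_bc; rewrite (box_key_inj eq_r eq_c) eqxx.
lia.
Qed.

Lemma in_secondE b : in_second b = (n <= row_key b).
Proof. by case: b => b /=; rewrite ?leq_addr // leqNgt ltn_ord. Qed.

Lemma bibox_ltE b c : bibox_lt b c =
  [&& in_second b == in_second c, row_key b <= row_key c, col_key b <= col_key c,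
      (row_key b == row_key c) || (col_key b == col_key c)
    & (row_key b < row_key c) || (col_key b < col_key c)].
Proof.
case: b c => [b|b] [c|c] //=; rewrite /box_lt -!(inj_eq val_inj) /=; lia.
Qed.

Definition descent Q (k : nat) : bool :=
  [exists b, exists c, [&& Q b == k :> nat, Q c == k.+1 :> nat & rows_below b c]].

Definition compatible la Q : bool :=
  [forall b, odd (nth 0 la (Q b)) == in_second b] &&
  [forall k : 'I_n, descent Q k ==> (nth 0 la k.+1 < nth 0 la k)].

Lemma SYT_bij Q : is_SYT Q -> bijective Q.
Proof.
case/andP=> /forallP one _.
have oneP v : exists b, [set b | Q b == v] = [set b] by apply/cards1P/one.
have /fin_all_exists[Q' Q'P] := oneP.
have QQ' b : Q' (Q b) = b.
  by apply/eqP; rewrite eq_sym -in_set1 -Q'P inE.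
exists Q' => // v; have : Q' v \in [set b | Q b == v] by rewrite Q'P set11.
by rewrite inE => /eqP.
Qed.

Lemma bij_SYT Q : bijective Q -> (forall b c, bibox_lt b c -> Q b < Q c) -> is_SYT Q.
Proof.
move=> [Q' QK Q'K] lt_Q; apply/andP; split; last first.
  by apply/forallP=> b; apply/forallP=> c; apply/implyP/lt_Q.
apply/forallP=> v; apply/cards1P; exists (Q' v); apply/setP=> b.
by rewrite !inE; apply/eqP/eqP=> [<-|->].
Qed.

Lemma SYT_lt Q b c : is_SYT Q -> bibox_lt b c -> Q b < Q c.
Proof. by case/andP=> _ /forallP/(_ b)/forallP/(_ c)/implyP. Qed.

Lemma sorted_nth la i j : sorted geq la -> i <= j -> nth 0 la j <= nth 0 la i.
Proof.
move=> la_sort le_ij; have [lt_j|] := ltnP j (size la); last by move/(nth_default 0)->.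
have tr : transitive geq by move=> y x z /= yx zy; apply: leq_trans yx.
have refl : reflexive geq by move=> x /=.
apply: (sorted_leq_nth tr refl 0 la_sort) => //; rewrite inE //.
exact: leq_ltn_trans lt_j.
Qed.

(** Comparing consecutive entries is enough. If their exponents tie, compatibility excludes a
    descent, so the next box is in a higher row or, by standardness, further right in the same row,
    as [tie] demands. *)
Lemma SYT_std_lt la Q : sorted geq la -> is_SYT Q -> compatible la Q ->
  forall b c, (Q b < Q c) = std_lt (fun b => nth 0 la (Q b)) b c.
Proof.
move=> la_sort Q_SYT /andP[_ /forallP desQ].
have [Q' QK Q'K] := SYT_bij Q_SYT.
set E := fun b => nth 0 la (Q b); have [irr tr tot] := std_total E.
have step b c : Q c = (Q b).+1 :> nat -> std_lt E b c.
  move=> eq_c; have : E c <= E b by apply: sorted_nth; rewrite ?eq_c.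
  have := desQ (Q b); rewrite -eq_c -!/(E _) => /implyP des_b.
  rewrite /std_lt leq_eqVlt => /orP[/eqP eq_E|->//]; rewrite eq_E ltnn eqxx /= /tie.
  have [//|lt_r|eq_r] := ltngtP (row_key c) (row_key b).
    have : E c < E b.
      apply: des_b; apply/existsP; exists b; apply/existsP; exists c.
      by rewrite eq_c !eqxx rows_belowE.
    by rewrite eq_E ltnn.
  have [//|lt_c|eq_col] := ltngtP (col_key b) (col_key c).
    have : Q c < Q b by apply: SYT_lt => //; rewrite bibox_ltE !in_secondE eq_r; lia.
    by rewrite eq_c; lia.
  by have := box_key_inj eq_r (esym eq_col); move: eq_c => /[swap] ->; lia.
have mono d b c : Q c = Q b + d.+1 :> nat -> std_lt E b c.
  elim: d b c => [|d IHd] b c eq_d; first by apply: step; rewrite eq_d addn1.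
  have lt_b1 : (Q b).+1 < n by have := ltn_ord (Q c); lia.
  have Qb1 : Q (Q' (Ordinal lt_b1)) = (Q b).+1 :> nat by rewrite Q'K.
  by apply: (tr (Q' (Ordinal lt_b1))); [apply: step|apply: IHd; rewrite Qb1; lia].
move=> b c; apply/idP/idP=> [lt_bc|lt_bc]; first by apply: (mono (Q c - (Q b).+1)); lia.
have [//|lt_cb|/ord_inj/(can_inj QK) eq_bc] := ltngtP (Q b) (Q c).
  have lt_bc' : std_lt E c b by apply: (mono (Q b - (Q c).+1)); lia.
  by have := tr _ _ _ lt_bc lt_bc'; rewrite irr.
by rewrite eq_bc irr in lt_bc.
Qed.

Variable N' : nat.
Local Notation N := N'.+1.
Variable la : seq nat.
Hypothesis size_la : size la = n.
Hypothesis sorted_la : sorted geq la.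
Hypothesis la_max : all (fun e => e < 2 * N) la.

Lemma semistandard_pairP (T : {ffun box mu.1 -> 'I_N} * {ffun box mu.2 -> 'I_N})
    (E := fun b => exponent (bifun T b)) :
  reflect (forall b c, bibox_lt b c ->
             if row_key b == row_key c then E c <= E b else E c < E b)
          (semistandard T.1 && semistandard T.2).
Proof.
have le_l (i j : 'I_N) : (exponent (lshift N i) <= exponent (lshift N j)) = (j <= i).
  by rewrite !exponent_lshift; have := ltn_ord i; have := ltn_ord j; lia.
have le_r (i j : 'I_N) : (exponent (rshift N i) <= exponent (rshift N j)) = (j <= i).
  by rewrite !exponent_rshift; have := ltn_ord i; have := ltn_ord j; lia.
have lt_l (i j : 'I_N) : (exponent (lshift N i) < exponent (lshift N j)) = (j < i).
  by rewrite ltnNge le_l -ltnNge.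
have lt_r (i j : 'I_N) : (exponent (rshift N i) < exponent (rshift N j)) = (j < i).
  by rewrite ltnNge le_r -ltnNge.
apply: (iffP andP) => [[/semistandardP ss1 /semistandardP ss2]|ssE].
  move=> [b|b] [c|c] //= lt_bc; rewrite /E /bifun.
    by have := ss1 _ _ lt_bc; rewrite /= -(inj_eq val_inj (sval b).1) le_l lt_l.
  by have := ss2 _ _ lt_bc; rewrite /= -(inj_eq val_inj (sval b).1) eqn_add2l le_r lt_r.
split; apply/semistandardP=> b c lt_bc.
  have := ssE (inl b) (inl c) lt_bc; rewrite /E /bifun /= le_l lt_l.
  by rewrite (inj_eq val_inj (sval b).1).
have := ssE (inr b) (inr c) lt_bc; rewrite /E /bifun /= le_r lt_r.
by rewrite eqn_add2l (inj_eq val_inj (sval b).1).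
Qed.

Definition compatible_SYT : {set {ffun bibox mu -> 'I_n}} :=
  [set Q | is_SYT Q && compatible la Q].

(** [N' - e./2] inverts [exponent]; the parity of [e] is accounted for by the component. *)
Definition to_semistandard Q : {ffun box mu.1 -> 'I_N} * {ffun box mu.2 -> 'I_N} :=
  ([ffun b => inord (N' - (nth 0 la (Q (inl b)))./2)],
   [ffun b => inord (N' - (nth 0 la (Q (inr b)))./2)]).

Lemma exponent_to_semistandard Q b : compatible la Q ->
  exponent (bifun (to_semistandard Q) b) = nth 0 la (Q b).
Proof.
case/andP=> /forallP odd_Q _; have := odd_Q b.
have lt_E : nth 0 la (Q b) < 2 * N by apply/(all_nthP 0 la_max); rewrite size_la.
have inordE x (o : bool) : x < 2 * N -> odd x == o ->
    2 * (N' - (inord (N' - x./2) : 'I_N)) + o = x.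
  by move=> lt_x odd_x; rewrite inordK; lia.
case: b lt_E => b lt_E odd_E; have := inordE _ _ lt_E odd_E.
  by rewrite exponent_lshift /= ffunE addn0.
by rewrite exponent_rshift /= ffunE.
Qed.

Lemma perm_bij Q : bijective Q -> perm_eq [seq nth 0 la (Q b) | b <- enum {: bibox mu}] la.
Proof.
move=> [Q' QK Q'K]; rewrite (map_comp (fun i : 'I_n => nth 0 la i) Q).
have la_map : [seq nth 0 la i | i <- map val (enum 'I_n)] = la.
  by rewrite val_enum_ord -/(mkseq _ _) -size_la mkseq_nth.
rewrite -[X in perm_eq _ X]la_map -[X in perm_eq _ X]map_comp; apply: perm_map.
apply: uniq_perm; rewrite ?enum_uniq //.
  by rewrite (map_inj_uniq (can_inj QK)) enum_uniq.
move=> i; rewrite mem_enum -[i]Q'K; apply/mapP; exists (Q' i) => //.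
by rewrite mem_enum.
Qed.

Lemma to_semistandard_content Q : Q \in compatible_SYT ->
  to_semistandard Q \in semistandard_content N' mu la.
Proof.
rewrite inE => /andP[Q_SYT Q_la]; have lt_Q := SYT_std_lt sorted_la Q_SYT Q_la.
have Q_bij := SYT_bij Q_SYT.
have expE b := exponent_to_semistandard b Q_la.
rewrite inE andbA; apply/andP; split; last by rewrite (eq_map expE) perm_bij.
apply/semistandard_pairP=> b c lt_bc; rewrite !expE.
have := SYT_lt Q_SYT lt_bc; rewrite lt_Q /std_lt /tie.
by move: lt_bc; rewrite bibox_ltE; case: (row_key b =P row_key c); lia.
Qed.

Lemma to_semistandard_inj : {in compatible_SYT &, injective to_semistandard}.
Proof.
move=> Q1 Q2; rewrite !inE => /andP[SYT1 la1] /andP[SYT2 la2] eq_T.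
have eq_E b : nth 0 la (Q1 b) = nth 0 la (Q2 b).
  by rewrite -!exponent_to_semistandard // eq_T.
apply/ffunP=> b; apply: ord_inj.
have lt1 := SYT_std_lt sorted_la SYT1 la1; have lt2 := SYT_std_lt sorted_la SYT2 la2.
rewrite (rank_unique (SYT_bij SYT1) lt1) (rank_unique (SYT_bij SYT2) lt2).
by apply: eq_card => c; rewrite !inE /std_lt !eq_E.
Qed.

(** The preimage numbers the boxes by rank in [std_lt]. A descent between consecutive ranks
    contradicts [tie], so the exponent drops strictly there. *)
Lemma to_semistandard_onto T : T \in semistandard_content N' mu la ->
  exists2 Q, Q \in compatible_SYT & T = to_semistandard Q.
Proof.
rewrite inE andbA => /andP[/semistandard_pairP ssT perm_T].
set E := fun b => exponent (bifun T b) in ssT; have tot := std_total E.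
have card_b : #|{: bibox mu}| = n.
  by rewrite cardE -(size_map E) (perm_size perm_T).
have lt_n b : rank (std_lt E) b < n by rewrite -[X in _ < X]card_b; apply: rank_max.
pose Q : {ffun bibox mu -> 'I_n} := [ffun b => Ordinal (lt_n b)].
have QE b : Q b = rank (std_lt E) b :> nat by rewrite ffunE.
have nthQ b : nth 0 la (Q b) = E b.
  rewrite QE; apply: (nth_rank tot) => //; last by rewrite perm_sym.
  by move=> c d; rewrite /std_lt; lia.
have Q_bij : bijective Q.
  apply: inj_card_bij; last by rewrite card_b card_ord.
  by move=> b c /(congr1 val); rewrite /= !QE => /(rank_inj tot).
have Q_SYT : is_SYT Q.
  apply: bij_SYT => // b c lt_bc; rewrite !QE (rank_lt tot) /std_lt /tie.
  have := ssT b c lt_bc; rewrite -!/(E _); move: lt_bc; rewrite bibox_ltE.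
  case: (row_key b =P row_key c); lia.
have Q_la : compatible la Q.
  apply/andP; split; [apply/forallP=> b|apply/forallP=> k].
    by rewrite nthQ /E; case: b => b; rewrite /= ?exponent_lshift ?exponent_rshift; lia.
  apply/implyP=> /existsP[b /existsP[c /and3P[/eqP eq_b /eqP eq_c below]]].
  rewrite -eq_c -eq_b !nthQ; have := rank_lt tot b c.
  by rewrite -!QE eq_b eq_c ltnSn /std_lt /tie; move: below; rewrite rows_belowE; lia.
exists Q; first by rewrite inE Q_SYT.
have eq_T b : bifun (to_semistandard Q) b = bifun T b.
  by apply: exponent_inj; rewrite exponent_to_semistandard // nthQ.
rewrite [T]surjective_pairing; congr pair; apply/ffunP=> b.
  by have := eq_T (inl b) => /= /lshift_inj->.
by have := eq_T (inr b) => /= /rshift_inj->.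
Qed.

Lemma card_semistandard_content : #|semistandard_content N' mu la| = #|compatible_SYT|.
Proof.
rewrite -(card_in_imset to_semistandard_inj); apply: eq_card => T.
apply/idP/imsetP=> [/to_semistandard_onto//|[Q Q_la ->]].
exact: to_semistandard_content.
Qed.

End Standardization.

(** * Signed cycle types *)

Section CycleTypes.

Variable n : nat.
Implicit Types (mu nu : Defs.shape n * Defs.shape n) (la : Defs.shape n).

Lemma sum_box la (G : 'I_n -> nat) : \sum_(b : box la) G (val b).1 = \sum_r la r * G r.
Proof.
rewrite -(big_sub (fun b : 'I_n * 'I_n => b.2 < la b.1) (fun b => G b.1)).
rewrite -(pair_big_dep xpredT (fun r c : 'I_n => c < la r) (fun r _ => G r)) /=.
apply: eq_bigr => r _; rewrite sum_nat_const; congr (_ * _).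
have le_la : la r <= n by rewrite -ltnS.
have inj_w : injective (widen_ord le_la) by move=> i j /(congr1 val)/= /val_inj.
rewrite -[RHS]card_ord -(card_imset _ inj_w); apply: eq_card => c.
apply/idP/imsetP=> [lt_c|[c' _ ->]]; last exact: (ltn_ord c').
by exists (Ordinal lt_c) => //; apply: val_inj.
Qed.

Definition row_length mu (b : bibox mu) : nat :=
  match b with inl b => mu.1 (val b).1 | inr b => mu.2 (val b).1 end.

Lemma row_length_gt0 mu (b : bibox mu) : 0 < row_length b.
Proof. by case: b => -[[r c] /= lt_c]; apply: leq_ltn_trans lt_c. Qed.

Lemma card_bibox mu : is_bipart mu -> #|{: bibox mu}| = n.
Proof.
case/and3P=> _ _ /eqP sum_mu; rewrite card_sum -[RHS]sum_mu -!sum1_card.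
congr (_ + _); rewrite (sum_box _ (fun=> 1)); by under eq_bigr do rewrite muln1.
Qed.

Fact rotate_subproof la (b : box la) (k : nat) :
  ((val b).2 + k) %% la (val b).1 < la (val b).1.
Proof. by rewrite ltn_pmod // (leq_ltn_trans (leq0n _) (valP b)). Qed.

Fact rotate_bound la (b : box la) (k : nat) : ((val b).2 + k) %% la (val b).1 < n.
Proof. by apply: leq_trans (rotate_subproof b k) _; rewrite -ltnS. Qed.

Definition rotate_box la (k : nat) (b : box la) : box la :=
  exist _ ((val b).1, Ordinal (rotate_bound b k)) (rotate_subproof b k).

Definition rotate mu (k : nat) (b : bibox mu) : bibox mu :=
  match b with inl b => inl (rotate_box k b) | inr b => inr (rotate_box k b) end.

Lemma col_rotate mu k (b : bibox mu) : col_key (rotate k b) = (col_key b + k) %% row_length b.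
Proof. by case: b. Qed.

Lemma row_length_rotate mu k (b : bibox mu) : row_length (rotate k b) = row_length b.
Proof. by case: b. Qed.

Lemma in_second_rotate mu k (b : bibox mu) : in_second (rotate k b) = in_second b.
Proof. by case: b. Qed.

Lemma row_key_rotate mu k (b : bibox mu) : row_key (rotate k b) = row_key b.
Proof. by case: b. Qed.

Lemma col_lt mu (b : bibox mu) : col_key b < row_length b.
Proof. by case: b => -[]. Qed.

Lemma rotate0 mu (b : bibox mu) : rotate 0 b = b.
Proof.
apply: box_key_inj; first exact: row_key_rotate.
by rewrite col_rotate addn0 modn_small ?col_lt.
Qed.

Lemma rotate1 mu k (b : bibox mu) : rotate 1 (rotate k b) = rotate k.+1 b.
Proof.
apply: box_key_inj; first by rewrite !row_key_rotate.
by rewrite !col_rotate row_length_rotate modnDml addn1 addnS.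
Qed.

Section CycleTypeElement.

Variables (mu : Defs.shape n * Defs.shape n) (bip : is_bipart mu).

Definition label (b : bibox mu) : 'I_n := cast_ord (card_bibox bip) (enum_rank b).
Definition unlabel (i : 'I_n) : bibox mu := enum_val (cast_ord (esym (card_bibox bip)) i).

Lemma labelK : cancel label unlabel.
Proof. by move=> b; rewrite /unlabel /label cast_ordK enum_rankK. Qed.

Lemma unlabelK : cancel unlabel label.
Proof. by move=> i; rewrite /unlabel /label enum_valK cast_ordKV. Qed.

(* The [k]-th power of an element of signed cycle type [mu]: rows of [mu] rotate,
   and those of [mu.2] change sign each time they wrap around. *)
Definition rotate_signed (k : nat) (z : 'I_n * bool) : 'I_n * bool :=
  let b := unlabel z.1 in
  (label (rotate k b), z.2 (+) (in_second b && odd ((col_key b + k) %/ row_length b))).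

Lemma rotate_signed0 z : rotate_signed 0 z = z.
Proof.
by case: z => i e; rewrite /rotate_signed rotate0 unlabelK addn0 divn_small ?col_lt // andbF addbF.
Qed.

Lemma rotate_signed1 k z : rotate_signed 1 (rotate_signed k z) = rotate_signed k.+1 z.
Proof.
rewrite /rotate_signed /= labelK rotate1 col_rotate row_length_rotate in_second_rotate.
congr pair; rewrite -addbA; congr addb; case: (in_second _) => //=.
set l := row_length _; have l_gt0 : 0 < l := row_length_gt0 _.
rewrite [in RHS]addnS; set x := col_key _ + k.
(* One more step adds one wrap exactly when the current column is the last of its row. *)
have -> : x.+1 %/ l = x %/ l + (x %% l + 1) %/ l.
  by rewrite {1}(divn_eq x l) -addn1 -addnA divnMDl.
by rewrite oddD.
Qed.

Lemma rotate_signed1_inj : injective (rotate_signed 1).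
Proof.
move=> [i e] [j f] eq_z; have /(can_inj labelK) := congr1 fst eq_z.
have := congr1 snd eq_z; rewrite /=; set b := unlabel i; set c := unlabel j => eq_s eq_r.
have eq_bc : b = c.
  apply: box_key_inj; first by rewrite -(row_key_rotate 1) eq_r row_key_rotate.
  have eq_l : row_length b = row_length c by rewrite -(row_length_rotate 1) eq_r row_length_rotate.
  have /eqP := congr1 (@col_key n mu) eq_r; rewrite !col_rotate eq_l eqn_modDr.
  by rewrite -{1}eq_l !modn_small ?col_lt // => /eqP.
move: eq_s; rewrite eq_bc => /addIb->; congr pair.
by rewrite -[i]unlabelK -[j]unlabelK -/b -/c eq_bc.
Qed.

Definition cycle_elt : {perm 'I_n * bool} := perm rotate_signed1_inj.

Lemma cycle_elt_iter k z : (cycle_elt ^+ k)%g z = rotate_signed k z.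
Proof.
rewrite permX; elim: k => [|k IHk]; first by rewrite rotate_signed0.
by rewrite iterS IHk permE rotate_signed1.
Qed.

Lemma cycle_elt_B : cycle_elt \in B n.
Proof. by apply/BsetP=> -[i e]; rewrite !permE /rotate_signed /opp_signed /= addNb. Qed.

Lemma cycle_elt_fix k (o : bool) z :
  ((cycle_elt ^+ k)%g z == (z.1, z.2 (+) o)) =
  (row_length (unlabel z.1) %| k) &&
    ((in_second (unlabel z.1) && odd (k %/ row_length (unlabel z.1))) == o).
Proof.
rewrite cycle_elt_iter /rotate_signed; set b := unlabel z.1; set l := row_length b.
have lt_c : col_key b < l := col_lt b.
rewrite xpair_eqE /= (inj_eq (@addbI _)) -[X in label _ == X]unlabelK -/b.
rewrite (inj_eq (can_inj labelK)).
have -> : (rotate k b == b) = (l %| k).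
  apply/eqP/idP=> [/(congr1 (@col_key n mu))|dvd_k].
    rewrite col_rotate -/l => /eqP; rewrite -{2}(modn_small lt_c) -[X in _ == X %[mod _]]addn0.
    by rewrite eqn_modDl mod0n.
  apply: box_key_inj; first exact: row_key_rotate.
  by rewrite col_rotate -/l -modnDmr (eqP dvd_k) addn0 modn_small.
case: (boolP (l %| k)) => //= dvd_k.
by rewrite divnDr // (divn_small lt_c).
Qed.

(** Points fixed by the power ([o = false]) or sent to their opposites ([o = true]): two counts
    invariant under conjugation in [B n], from which the rows are recovered. *)
Lemma card_cycle_elt_fix k (o : bool) :
  #|[set z | (cycle_elt ^+ k)%g z == (z.1, z.2 (+) o)]| =
  2 * #|[set b : bibox mu | (row_length b %| k) &&
                            ((in_second b && odd (k %/ row_length b)) == o)]|.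
Proof.
pose A := [set b : bibox mu | (row_length b %| k) &&
                            ((in_second b && odd (k %/ row_length b)) == o)].
have -> : [set z | (cycle_elt ^+ k)%g z == (z.1, z.2 (+) o)] =
    setX (label @: A) [set: bool].
  apply/setP=> z; rewrite !inE cycle_elt_fix andbT -[z.1 in RHS]unlabelK.
  by rewrite (mem_imset _ _ (can_inj labelK)) inE.
by rewrite cardsX cardsT card_bool mulnC card_imset //; apply: can_inj labelK.
Qed.

End CycleTypeElement.

Lemma card_fix_conj (s t : {perm 'I_n * bool}) k (o : bool) : t \in B n ->
  #|[set z | ((s ^ t) ^+ k)%g z == (z.1, z.2 (+) o)]| =
  #|[set z | (s ^+ k)%g z == (z.1, z.2 (+) o)]|.
Proof.
move=> /BsetP tB; rewrite -[RHS](card_imset _ (@perm_inj _ t)); apply: eq_card => z.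
have to z' : t (z'.1, z'.2 (+) o) = ((t z').1, (t z').2 (+) o).
  case: z' => i e /=; case: o; last by rewrite !addbF; case: (t _).
  by rewrite !addbT; apply: (tB (i, e)).
rewrite inE -conjXg; apply/idP/imsetP=> [fix_z|[z' fix_z' ->]]; last first.
  by move: fix_z'; rewrite inE permJ -to => /eqP->.
exists (t^-1 z)%g; last by rewrite permKV.
move: fix_z; rewrite inE -{1 2 3}[z](permKV t) permJ -to.
by rewrite (inj_eq perm_inj).
Qed.

Definition multiplicity_of la (l : nat) : nat := \sum_(r < n) (la r == l :> nat).

(** The numbers of parts above each threshold determine the sequence; zero parts are above none,
    hence positive [l] only. *)
Lemma part_eq la la' : is_part la -> is_part la' ->
  (forall l, 0 < l -> multiplicity_of la l = multiplicity_of la' l) -> la = la'.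
Proof.
move=> la_part la'_part eq_mult.
have nthE (nu : Defs.shape n) r : val (nu r) = nth 0 [seq val (nu r) | r <- enum 'I_n] r.
  by rewrite (nth_map r) ?size_enum_ord // nth_ord_enum.
have sort_la (nu : Defs.shape n) : is_part nu -> sorted geq [seq val (nu r) | r <- enum 'I_n].
  move=> /forallP nu_part; apply/(sortedP 0) => i; rewrite size_map size_enum_ord => lt_i.
  have := nthE nu (Ordinal lt_i); have := nthE nu (Ordinal (ltnW lt_i)).
  move=> /= <- <-; have /forallP/(_ (Ordinal lt_i))/implyP := nu_part (Ordinal (ltnW lt_i)).
  by apply; apply: leqnSn.
have countE (nu : Defs.shape n) v : count (ltn v) [seq val (nu r) | r <- enum 'I_n] =
    \sum_(l < n.+1 | v < l) multiplicity_of nu l.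
  rewrite count_map -sum1_count big_enum_cond /=.
  rewrite (partition_big nu (fun l => v < l)) //=; apply: eq_bigr => l lt_vl.
  rewrite /multiplicity_of big_mkcond; apply: eq_bigr => r _.
  rewrite -(inj_eq val_inj) /=; case: eqP => [eq_l|]; last by rewrite andbF.
  by rewrite eq_l lt_vl.
apply/ffunP=> r; apply: val_inj.
have lt_eq v : (v < val (la r)) = (v < val (la' r)).
  rewrite !nthE !ltn_nth_sorted ?sort_la // !countE.
  by congr (_ < _); apply: eq_bigr => l lt_vl; apply: eq_mult; apply: leq_ltn_trans lt_vl.
have := lt_eq (val (la r)); rewrite ltnn => /esym/negbT; rewrite -leqNgt => le1.
have := lt_eq (val (la' r)); rewrite ltnn => /negbT; rewrite -leqNgt => le2.
by apply/eqP; rewrite eqn_leq le1 le2.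
Qed.

(** Inversion of a divisor sum, triangular with diagonal coefficient [w 1]. *)
Lemma divisor_sum_inj (w : nat -> nat) (f g : nat -> nat) : w 1 = 1 ->
  (forall k, 0 < k -> \sum_(d < k.+1 | d %| k) w (k %/ d) * f d =
                      \sum_(d < k.+1 | d %| k) w (k %/ d) * g d) ->
  forall k, 0 < k -> f k = g k.
Proof.
move=> w1 eq_sum k; have [m] := ubnP k; elim: m k => // m IHm k; rewrite ltnS => le_km k_gt0.
have := eq_sum k k_gt0; rewrite (bigD1 ord_max) //= [in RHS](bigD1 ord_max) //=.
rewrite divnn k_gt0 w1 !mul1n.
have -> : \sum_(d < k.+1 | (d %| k) && (d != ord_max)) w (k %/ d) * f d =
    \sum_(d < k.+1 | (d %| k) && (d != ord_max)) w (k %/ d) * g d; last by move/addIn.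
apply: eq_bigr => d /andP[dvd_d ne_d]; congr (_ * _); apply: IHm.
  apply: leq_trans le_km; have := ltn_ord d; rewrite ltnS leq_eqVlt => /predU1P[eq_d|//].
  by case/eqP: ne_d; apply: val_inj.
by case: (val d) dvd_d => //; rewrite dvd0n; lia.
Qed.

Lemma card_divisors (T : finType) (l : T -> nat) (Q : pred T) (w : pred nat) k : 0 < k ->
  #|[set b | [&& l b %| k, Q b & w (k %/ l b)]]| =
  \sum_(d < k.+1 | d %| k) w (k %/ d) * #|[set b | Q b && (l b == d)]|.
Proof.
move=> k_gt0; rewrite -sum1dep_card.
rewrite (partition_big (fun b => inord (l b) : 'I_k.+1) (fun d => d %| k)) => [|b]; last first.
  by case/andP=> dvd_b _; rewrite inordK // ltnS dvdn_leq.
apply: eq_bigr => d dvd_d; rewrite -sum1dep_card big_distrr /= big_mkcond [RHS]big_mkcond /=.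
apply: eq_bigr => b _; have [eq_d|ne_d] := eqVneq (l b) d.
  by rewrite eq_d dvd_d inord_val eqxx andbT /=; case: (Q b); case: (w _).
rewrite andbF; case: ifP => // /andP[/and3P[dvd_b _ _] /eqP eq_d].
by case/eqP: ne_d; rewrite -eq_d inordK // ltnS dvdn_leq.
Qed.

Lemma card_row_length mu l : #|[set b : bibox mu | row_length b == l]| =
  l * (multiplicity_of mu.1 l + multiplicity_of mu.2 l).
Proof.
rewrite -sum1dep_card big_mkcond big_sumType /= mulnDr; congr (_ + _).
  rewrite (sum_box _ (fun r => if mu.1 r == l :> nat then 1 else 0)) big_distrr /=.
  by apply: eq_bigr => r _; case: eqP => [->|]; rewrite ?muln0.
rewrite (sum_box _ (fun r => if mu.2 r == l :> nat then 1 else 0)) big_distrr /=.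
by apply: eq_bigr => r _; case: eqP => [->|]; rewrite ?muln0.
Qed.

Lemma card_second_length mu l :
  #|[set b : bibox mu | in_second b && (row_length b == l)]| = l * multiplicity_of mu.2 l.
Proof.
rewrite -sum1dep_card big_mkcond big_sumType /= big1 // add0n.
rewrite (sum_box _ (fun r => if mu.2 r == l :> nat then 1 else 0)) big_distrr /=.
by apply: eq_bigr => r _; case: eqP => [->|]; rewrite ?muln0.
Qed.

Lemma cycle_elt_conj mu nu (bip_mu : is_bipart mu) (bip_nu : is_bipart nu) t :
  t \in B n -> cycle_elt bip_nu = (cycle_elt bip_mu ^ t)%g -> mu = nu.
Proof.
move=> tB eq_c.
have eq_fix k o := card_fix_conj (cycle_elt bip_mu) k o tB.
have {eq_fix eq_c}eq_A k (o : bool) :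
    #|[set b : bibox nu | (row_length b %| k) && ((in_second b && odd (k %/ row_length b)) == o)]| =
    #|[set b : bibox mu | (row_length b %| k) && ((in_second b && odd (k %/ row_length b)) == o)]|.
  by have := eq_fix k o; rewrite -eq_c !card_cycle_elt_fix; lia.
(* A row of length [l] is sent to its opposite by the [k]-th power when it lies in the second
   diagram and [k / l] is odd, hence the weight [odd]. *)
have eq_second l : 0 < l -> l * multiplicity_of nu.2 l = l * multiplicity_of mu.2 l.
  move: l; apply: (divisor_sum_inj (w := fun k => odd k)) => // k k_gt0.
  have sumE xi : \sum_(d < k.+1 | d %| k) odd (k %/ d) * (d * multiplicity_of xi.2 d) =
      #|[set b : bibox xi | (row_length b %| k) &&
          ((in_second b && odd (k %/ row_length b)) == true)]|.
    rewrite -(eq_card (A := [set b : bibox xi |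
        [&& row_length b %| k, in_second b & odd (k %/ row_length b)]])).
      by rewrite card_divisors //; apply: eq_bigr => d _; rewrite card_second_length.
    by move=> b; rewrite !inE eqb_id.
  by rewrite !sumE.
(* Regardless of sign, every row whose length divides [k] counts, hence the weight 1. *)
have eq_all l : 0 < l -> l * (multiplicity_of nu.1 l + multiplicity_of nu.2 l) =
    l * (multiplicity_of mu.1 l + multiplicity_of mu.2 l).
  move: l; apply: (divisor_sum_inj (w := fun=> 1)) => // k k_gt0.
  have sumE xi : \sum_(d < k.+1 | d %| k)
        1 * (d * (multiplicity_of xi.1 d + multiplicity_of xi.2 d)) =
      #|[set b : bibox xi | row_length b %| k]|.
    rewrite -(eq_card (A := [set b : bibox xi | [&& row_length b %| k, true & true]])).
      rewrite (card_divisors _ xpredT xpredT) //; apply: eq_bigr => d _.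
      by rewrite -card_row_length.
    by move=> b; rewrite !inE !andbT.
  have splitE xi : #|[set b : bibox xi | row_length b %| k]| =
     #|[set b : bibox xi | (row_length b %| k) &&
                             ((in_second b && odd (k %/ row_length b)) == true)]| +
     #|[set b : bibox xi | (row_length b %| k) &&
                             ((in_second b && odd (k %/ row_length b)) == false)]|.
    rewrite -(cardsID [set b | in_second b && odd (k %/ row_length b)]); congr (_ + _).
      by apply: eq_card => b; rewrite !inE eqb_id.
    by apply: eq_card => b; rewrite !inE eqbF_neg andbC.
  by rewrite !sumE !splitE !eq_A.
have eq2 l : 0 < l -> multiplicity_of mu.2 l = multiplicity_of nu.2 l.
  by move=> l_gt0; have /eqP := eq_second l l_gt0; rewrite eqn_pmul2l // => /eqP.
have eq1 l : 0 < l -> multiplicity_of mu.1 l = multiplicity_of nu.1 l.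
  by move=> l_gt0; have /eqP := eq_all l l_gt0; rewrite eqn_pmul2l // eq2 // => /eqP/addIn.
have [/and3P[mu1 mu2 _] /and3P[nu1 nu2 _]] := (bip_mu, bip_nu).
rewrite [mu]surjective_pairing [nu]surjective_pairing.
by rewrite (part_eq mu1 nu1 eq1) (part_eq mu2 nu2 eq2).
Qed.

Lemma card_bipartition_le : #|{: bipartition n}| <= Nirr (B n).
Proof.
pose cl (mu : bipartition n) : {set {perm 'I_n * bool}} :=
  (cycle_elt (valP mu) ^: B n)%g.
have cl_inj : injective cl.
  move=> mu nu eq_cl; apply: val_inj.
  have : cycle_elt (valP nu) \in cl mu by rewrite eq_cl class_refl.
  by case/imsetP=> t tB /(cycle_elt_conj tB).
rewrite NirrE -(card_imset _ cl_inj); apply: subset_leq_card.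
by apply/subsetP=> _ /imsetP[mu _ ->]; apply: mem_classes; apply: cycle_elt_B.
Qed.

End CycleTypes.

Local Open Scope ring_scope.

(** * Injectivity of the Frobenius indexing *)

Section Surjectivity.

Variable n : nat.
Implicit Types (o : {ffun 'I_n -> bool}) (p : {perm 'I_n}) (s : {perm 'I_n * bool}).

(** The spacing by 2 leaves room for any parities [o] while keeping the exponents distinct, so that
    only the identity permutation fixes them. *)
Definition strict_exp o (i : 'I_n) : nat := (2 * (n - i.+1) + o i)%N.
Definition strict_seq o : seq nat := [seq strict_exp o i | i <- enum 'I_n].
Definition strict_mnm o p : 'X_{1..n} := [multinom strict_exp o (p i) | i < n].

Lemma strict_exp_lt o (i j : 'I_n) : (i < j)%N -> (strict_exp o j < strict_exp o i)%N.
Proof. by rewrite /strict_exp; have := ltn_ord j; case: (o i); case: (o j); lia. Qed.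

Lemma strict_exp_inj o : injective (strict_exp o).
Proof.
move=> i j eq_ij; apply: val_inj; case: (ltngtP (val i) (val j)) => // /(strict_exp_lt o);
by rewrite eq_ij ltnn.
Qed.

Lemma strict_seq_max o : all (fun e => (e < 2 * n.+1)%N) (strict_seq o).
Proof.
by apply/allP=> _ /mapP[i _ ->]; rewrite /strict_exp; have := ltn_ord i; case: (o i); lia.
Qed.

Lemma strict_seq_sorted o : sorted geq (strict_seq o).
Proof.
apply/(sortedP 0%N) => i; rewrite size_map size_enum_ord => lt_i.
have nthE (k : 'I_n) : nth 0%N (strict_seq o) k = strict_exp o k.
  by rewrite (nth_map k) ?size_enum_ord // nth_ord_enum.
have := nthE (Ordinal lt_i); have := nthE (Ordinal (ltnW lt_i)) => /= -> ->.
by apply/ltnW/strict_exp_lt.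
Qed.

Lemma strict_monomials o :
  perm_eq (monomials n (strict_seq o)) [seq strict_mnm o p | p <- index_enum {perm 'I_n}].
Proof.
have mnm_inj : injective (strict_mnm o).
  move=> p q /mnmP eq_m; apply/permP=> i; have := eq_m i.
  by rewrite !mnmE => /strict_exp_inj.
apply: uniq_perm; first exact: monomials_uniq.
  by rewrite (map_inj_uniq mnm_inj) index_enum_uniq.
move=> m; rewrite mem_monomials.
have tr : transitive geq by move=> x y z /= xy yz; apply: leq_trans xy.
have anti : antisymmetric geq by move=> x y /= /andP[xy yx]; apply/eqP; rewrite eqn_leq xy yx.
apply/eqP/mapP=> [part_m|[p _ ->]].
  have : perm_eq m (mktuple (strict_exp o)).
    by rewrite -(perm_sort geq) -/(mpart m) part_m.
  case/tuple_permP=> p def_m; exists p; rewrite ?mem_index_enum //.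
  apply/mnmP=> i; rewrite mnmE mnm_tnth -(tnth_mktuple (strict_exp o)).
  have -> : multinom_val m = [tuple tnth (mktuple (strict_exp o)) (p i) | i < n] by apply: val_inj.
  by rewrite tnth_mktuple.
apply: (sorted_eq tr anti (sorted_mpart _) (strict_seq_sorted o)).
rewrite (permPl (perm_mpart _)).
rewrite (eq_map (g := fun i => strict_exp o (p i))) => [|i]; last by rewrite mnmE.
rewrite (map_comp (strict_exp o) p); apply: perm_map; apply: uniq_perm; rewrite ?enum_uniq //.
  by rewrite (map_inj_uniq (@perm_inj _ p)) enum_uniq.
by move=> i; rewrite mem_enum; apply/mapP; exists ((p^-1)%g i); rewrite ?mem_enum ?permKV.
Qed.

(* Every pattern of parities occurs once, so this is a multiple of the regular
   character. *)
Definition strict_trace s : rat :=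
  \sum_o \sum_(m <- monomials n (strict_seq o)) (Bact s 'X_[m])@_m.

Lemma strict_traceE s :
  strict_trace s = \sum_p \sum_o (Bact s 'X_[strict_mnm o p])@_(strict_mnm o p).
Proof.
rewrite exchange_big; apply: eq_bigr => o _.
by rewrite (perm_big _ (strict_monomials o)) big_map.
Qed.

Lemma strict_trace1 : strict_trace 1%g != 0.
Proof.
rewrite strict_traceE.
under eq_bigr do under eq_bigr do rewrite Bact1 mcoeffX eqxx.
rewrite sumr_const sumr_const -mulrnA Num.Theory.pnatr_eq0 -lt0n muln_gt0.
apply/andP; split; apply/card_gt0P; [by exists [ffun=> false]|by exists 1%g].
Qed.

(** Either |s| moves a variable, and distinct exponents leave no diagonal term, or some sign
    changes, and summing over parities cancels. *)
Lemma strict_trace0 s : s \in B n -> s != 1%g -> strict_trace s = 0.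
Proof.
move=> sB ne_s; rewrite strict_traceE; apply: big1 => p _.
have [/forallP abs_s|/forallPn[i ne_i]] := boolP [forall i, sabs s i == i]; last first.
  apply: big1 => o _; rewrite coef_Bact // ifF //; apply/forallP=> /(_ i).
  rewrite !mnmE => /eqP/strict_exp_inj/perm_inj eq_i.
  by rewrite eq_i eqxx in ne_i.
have [i neg_i] : exists i, sneg s i.
  apply/existsP; apply: contraNT ne_s; rewrite negb_exists => /forallP pos_s.
  have s_false i : s (i, false) = (i, false).
    have := pos_s i; have := eqP (abs_s i); rewrite /sabs /sneg.
    by case: (s _) => j [] //= ->.
  apply/eqP/permP=> -[i []]; rewrite perm1 //.
  have /BsetP sP := sB.
  by rewrite -[(i, true)]/(opp_signed (i, false)) sP s_false.
(* The sum over [o] factors over positions; the factor at a sign change is [-1 + 1]. *)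
pose c (j : 'I_n) (b : bool) : rat := (-1) ^+ (sneg s ((p^-1)%g j) && b).
rewrite (eq_bigr (fun o => \prod_j c j (o j))) => [|o _].
  rewrite -(bigA_distr_bigA c) (bigD1 (p i)) //= big_bool /c permK neg_i /=.
  by rewrite expr1 expr0 addNr mul0r.
rewrite coef_Bact // ifT; last by apply/forallP=> j; rewrite (eqP (abs_s j)).
rewrite [RHS](reindex_inj (@perm_inj _ p)); apply: eq_bigr => j _.
rewrite /c permK mnmE /strict_exp; congr (_ ^+ (_ && _)).
by case: (o (p j)); lia.
Qed.

Variable chi : bipartition n -> Iirr (B n).
Hypothesis frob : frobenius chi.

Lemma frobenius_surj th : exists mu, chi mu = th.
Proof.
have [[mu /eqP]|no_mu] := pselect (exists mu, chi mu == th); first by exists mu.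
pose Ph : 'CF(B n) := \sum_(o : {ffun 'I_n -> bool}) \sum_mu
  #|semistandard_content n (val mu) (strict_seq o)|%:R *: 'chi_(chi mu).
have PhE s : s \in B n -> Ph s = ratr (strict_trace s).
  move=> sB; rewrite /Ph /strict_trace rmorph_sum sum_cfunE; apply: eq_bigr => o _ /=.
  rewrite (frobenius_monomials sB frob (strict_seq_max o) (strict_seq_sorted o)).
  by rewrite sum_cfunE; apply: eq_bigr => mu _; rewrite cfunE.
(* A missed [th] is orthogonal to [Ph]; but [Ph] is supported at the identity, where neither factor
   vanishes. *)
have : '[Ph, 'chi_th] = 0.
  rewrite cfdot_suml big1 // => o _; rewrite cfdot_suml big1 // => mu _.
  rewrite cfdotZl cfdot_irr; case: eqP => [eq_mu|_]; last by rewrite mulr0.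
  by case: no_mu; exists mu; rewrite eq_mu.
rewrite cfdotE (bigD1 1%g) //= big1 ?addr0 => [|s /andP[sB ne_s]]; last first.
  by rewrite PhE // strict_trace0 // rmorph0 mul0r.
move/eqP; rewrite !mulf_eq0 PhE ?group1 // fmorph_eq0 Num.Theory.conjC_eq0 (negPf (irr1_neq0 _)).
by rewrite (negPf strict_trace1) invr_eq0 (negPf (neq0CG _)).
Qed.

Lemma frobenius_inj : injective chi.
Proof.
have sur : codom chi =i predT.
  by move=> th; rewrite inE; have [mu <-] := frobenius_surj th; apply: codom_f.
apply/injectiveP/card_uniqP; rewrite (eq_card sur) size_map -cardE.
apply/eqP; rewrite eqn_leq; apply/andP; split; last first.
  by rewrite card_ord; apply: card_bipartition_le.
by rewrite -(eq_card sur) (leq_trans (card_size _)) // size_map -cardE.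
Qed.

End Surjectivity.

Local Close Scope ring_scope.

(** * Descent classes *)

Section DescentClasses.

Variables (n : nat) (mu : Defs.shape n * Defs.shape n).
Implicit Types (Q : {ffun bibox mu -> 'I_n}) (la : seq nat) (D : {set 'I_n}) (k : 'I_n).

(** The counterpart of [weight_sum], with descents of the tableau in place of those of the positions
    in a monomial. *)
Definition reduced_SYT la D : {set {ffun bibox mu -> 'I_n}} :=
  [set Q | [&& is_SYT Q, compatible la Q & [forall k in D, gap la k (descent Q k) == 0]]].

Definition subk (k : nat) la : seq nat := mkseq (fun l => nth 0 la l - 2 * (l <= k)) (size la).

Lemma nth_subk (k : nat) la l : nth 0 (subk k la) l = nth 0 la l - 2 * (l <= k).
Proof.
have [lt_l|ge_l] := ltnP l (size la); first by rewrite nth_mkseq.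
by rewrite !nth_default ?size_mkseq.
Qed.

Lemma subkK la k : sorted geq la -> 2 <= nth 0 la k -> addk k (subk k la) = la.
Proof.
move=> la_sort ge2; apply: (@eq_from_nth _ 0); rewrite !size_mkseq // => l lt_l.
rewrite nth_mkseq ?size_mkseq // nth_subk; case: (leqP l k) => [le_lk|]; last by lia.
by have := sorted_nth la_sort le_lk; lia.
Qed.

Lemma sorted_subk la k : sorted geq la -> nth 0 la k.+1 + 2 <= nth 0 la k ->
  sorted geq (subk k la).
Proof.
move=> la_sort ge2; apply/(sortedP 0) => l _; rewrite !nth_subk /=.
have := sorted_nth la_sort (leqnSn l).
case: (ltngtP l k) => [lt_lk|lt_kl|->]; rewrite ?leqnn ?ltnn /=; lia.
Qed.

Lemma reduced_SYT_gap la D k : nth 0 la k < nth 0 la k.+1 + 2 ->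
  reduced_SYT la (k |: D) = reduced_SYT la D.
Proof.
move=> lt_gap; apply/setP=> Q; rewrite !inE forall_setU1.
by rewrite [X in _ && (_ && (_ && X))](_ : _ = true) ?andbT // /gap; lia.
Qed.

(** No tableau is modified: those excluded by the condition at [k] are exactly those still
    compatible once [la] is lowered. *)
Lemma card_reduced_SYT_subk la D k : size la = n -> sorted geq la -> k \notin D ->
  nth 0 la k.+1 + 2 <= nth 0 la k ->
  #|reduced_SYT la D| = #|reduced_SYT la (k |: D)| + #|reduced_SYT (subk k la) D|.
Proof.
move=> sz_la la_sort nDk ge2.
have ge2_le l : l <= k -> 2 <= nth 0 la l by move/(sorted_nth la_sort); lia.
have nth_ne (l : nat) : l != k :> nat ->
    (nth 0 la l - 2 * (l <= k)) - (nth 0 la l.+1 - 2 * (l < k)) =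
    nth 0 la l - nth 0 la l.+1.
  move=> ne_lk; have := ge2_le l; have := ge2_le l.+1.
  by have [lt_lk|lt_lk|eq_lk] := ltngtP l k; [lia|lia|rewrite eq_lk eqxx in ne_lk].
have lt_ne (l : nat) : l != k :> nat ->
    (nth 0 (subk k la) l.+1 < nth 0 (subk k la) l) = (nth 0 la l.+1 < nth 0 la l).
  by move=> ne_lk; rewrite -subn_gt0 !nth_subk nth_ne // subn_gt0.
pose A := [set Q | gap la k (descent Q k) == 0] : {set {ffun bibox mu -> 'I_n}}.
rewrite -[LHS](cardsID A (reduced_SYT la D)); congr (_ + _); apply: eq_card => Q; rewrite !inE.
  by rewrite forall_setU1 !andbA.
case: (is_SYT Q) => /=; last by rewrite andbF.
have -> : [forall l in D, gap (subk k la) l (descent Q l) == 0] =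
          [forall l in D, gap la l (descent Q l) == 0].
  apply: eq_forallb => l; case: (boolP (l \in D)) => //= Dl.
  have ne_lk : l != k :> nat by apply: contraNneq nDk => /val_inj <-.
  by rewrite /gap !nth_subk nth_ne.
rewrite andbA andbC [in RHS]andbC; case: [forall l in D, _] => //=; rewrite ?andbT.
rewrite /compatible; have -> : [forall b, odd (nth 0 (subk k la) (Q b)) == in_second b] =
    [forall b, odd (nth 0 la (Q b)) == in_second b].
  apply: eq_forallb => b; congr (_ == _); rewrite nth_subk.
  by case: (leqP (Q b) k) => [/(sorted_nth la_sort)|]; lia.
rewrite andbCA; case: [forall b, _] => //=.
(* With a difference of at least 2 at [k], a nonzero gap means that removing 2 still leaves a strict
   drop if there is a descent. *)
have gapE : (gap la k (descent Q k) != 0) =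
    (descent Q k ==> (nth 0 (subk k la) k.+1 < nth 0 (subk k la) k)).
  by rewrite /gap !nth_subk leqnn ltnn; case: (descent Q k); lia.
apply/andP/forallP=> [[gap_k /forallP des] l|des].
  have [->|ne_lk] := eqVneq l k; first by rewrite -gapE.
  have := des l; have {}ne_lk : l != k :> nat by apply: contraNneq ne_lk => /val_inj ->.
  by rewrite lt_ne.
split; first by rewrite gapE.
apply/forallP=> l; have [->|ne_lk] := eqVneq l k.
  by have := des k; rewrite -gapE /gap; case: descent; lia.
have := des l; have {}ne_lk : l != k :> nat by apply: contraNneq ne_lk => /val_inj ->.
by rewrite lt_ne.
Qed.

End DescentClasses.

(** * The exponent sequences attached to descent and negative sets *)

Section LambdaSS.

Variables (n : nat) (S1 : {set 'I_n.-1}) (S2 : {set 'I_n}).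
Let la : seq nat := lambda_SS S1 S2.

Lemma nth_lambda (i : 'I_n) : nth 0 la i = 2 * #|[set j in S1 | i <= j]| + (i \in S2).
Proof. by rewrite -[LHS](tnth_nth 0) tnth_mktuple. Qed.

Lemma odd_lambda (i : 'I_n) : odd (nth 0 la i) = (i \in S2).
Proof. by rewrite nth_lambda; case: (i \in S2); lia. Qed.

(** Additive form, because the difference of consecutive entries can be -1. *)
Lemma lambda_gap (i : 'I_n.-1) (u v : 'I_n) : u = i :> nat -> v = i.+1 :> nat ->
  nth 0 la i + (v \in S2) = nth 0 la i.+1 + 2 * (i \in S1) + (u \in S2).
Proof.
move=> eq_u eq_v; have := nth_lambda u; have := nth_lambda v; rewrite eq_u eq_v => -> ->.
rewrite (cardsD1 i [set j in S1 | i <= j]) inE leqnn andbT.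
have -> : [set j in S1 | i <= j] :\ i = [set j in S1 | i < j].
  by apply/setP=> j; rewrite !inE [i < j]ltn_neqAle eq_sym andbCA.
by rewrite mulnDr; ring.
Qed.

Lemma lambda_last (k : 'I_n) : n <= k.+1 -> nth 0 la k <= 1.
Proof.
move=> ge_k; rewrite nth_lambda (_ : [set j in S1 | k <= j] = set0) ?cards0.
  by case: (k \in S2).
apply/setP=> j; rewrite !inE; apply/negbTE; rewrite negb_and -ltnNge orbC.
have lt_jk : j < k by have := ltn_ord j; lia.
by rewrite lt_jk.
Qed.

Variables (mu : Defs.shape n * Defs.shape n) (Q : {ffun bibox mu -> 'I_n}).
Hypothesis Q_SYT : is_SYT Q.

Lemma mem_Des (i : 'I_n.-1) : (i \in Des Q) = descent Q i.
Proof. by rewrite inE. Qed.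

Lemma mem_Neg b : (Q b \in Neg Q) = in_second b.
Proof.
have Q_inj := bij_inj (SYT_bij Q_SYT).
by apply/imsetP/idP=> [[c _ /Q_inj ->]//|]; case: b => b // _; exists b.
Qed.

Lemma descent_bound k : descent Q k -> k.+1 < n.
Proof. by case/existsP=> b /existsP[c /and3P[_ /eqP<- _]]. Qed.

(** Consecutive entries in different diagrams descend exactly when the larger one is in the second,
    lower diagram. *)
Lemma descent_Neg (k : nat) (u v : 'I_n) : u = k :> nat -> v = k.+1 :> nat ->
  (v \in Neg Q) != (u \in Neg Q) -> descent Q k = (v \in Neg Q).
Proof.
move=> eq_u eq_v; have [Q' QK Q'K] := SYT_bij Q_SYT.
have memE w : (w \in Neg Q) = in_second (Q' w) by rewrite -{1}[w]Q'K mem_Neg.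
rewrite !memE => ne_uv.
apply/existsP/idP=> [[b /existsP[c /and3P[/eqP eq_b /eqP eq_c below]]]|v2].
  move: ne_uv; have -> : Q' v = c by rewrite -[c]QK; congr Q'; apply: ord_inj; rewrite eq_v eq_c.
  have -> : Q' u = b by rewrite -[b]QK; congr Q'; apply: ord_inj; rewrite eq_u eq_b.
  by case: b c below {eq_b eq_c} => [b|b] [c|c].
exists (Q' u); apply/existsP; exists (Q' v); rewrite !Q'K eq_u eq_v !eqxx /=.
by move: ne_uv v2; case: (Q' u) => b; case: (Q' v) => c.
Qed.

(** For equal parities, compatibility says that a descent lies in [S1] and a zero gap says the
    converse. For unequal parities, [descent_Neg] fixes the descent and the odd difference forces
    membership in [S1] to agree. *)
Lemma lambda_compatible : sorted geq la ->
  (compatible la Q && [forall k : 'I_n, gap la k (descent Q k) == 0]) =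
  (Des Q == S1) && (Neg Q == S2).
Proof.
move=> la_sort; have [Q' QK Q'K] := SYT_bij Q_SYT.
have NegE : [forall b, odd (nth 0 la (Q b)) == in_second b] = (Neg Q == S2).
  apply/forallP/eqP=> [odd_Q|eq_S2 b]; last by rewrite odd_lambda -eq_S2 mem_Neg.
  by apply/setP=> v; rewrite -[v]Q'K mem_Neg -odd_lambda; apply/esym/eqP/odd_Q.
rewrite /compatible NegE -andbA [RHS]andbC; case: (Neg Q =P S2) => //= eq_S2.
have uv (i : 'I_n.-1) : exists u : 'I_n, exists2 v : 'I_n, u = i :> nat & v = i.+1 :> nat.
  have lt_i : i.+1 < n by have := ltn_ord i; lia.
  by exists (Ordinal (ltnW lt_i)), (Ordinal lt_i).
have key (i : 'I_n.-1) : (descent Q i ==> (nth 0 la i.+1 < nth 0 la i)) &&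
    (gap la i (descent Q i) == 0) = (descent Q i == (i \in S1)).
  have [u [v eq_u eq_v]] := uv i; have := lambda_gap eq_u eq_v.
  have := descent_Neg eq_u eq_v; rewrite eq_S2 /gap.
  have := sorted_nth la_sort (leqnSn i).
  by case: (v \in S2); case: (u \in S2); case: (i \in S1) => /= le_la dN;
    try (have {}dN := dN isT); case: (descent Q i) dN; lia.
apply/andP/eqP=> [[/forallP des /forallP gap0]|eq_S1].
  apply/setP=> i; rewrite mem_Des; have [u [v eq_u eq_v]] := uv i.
  have := key i; have := des u; have := gap0 u; rewrite eq_u => -> ->.
  by move/esym/eqP.
(* The last position is outside [S1] and must be harmless: it has no descent, and its exponent is at
   most 1. *)
have last_k (k : 'I_n) : n <= k.+1 -> descent Q k = false.
  by move=> ge_k; apply/negbTE/negP=> /descent_bound; lia.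
split; apply/forallP=> k; (have [lt_k|ge_k] := ltnP k.+1 n; last first).
- by rewrite last_k.
- have lt_k' : k < n.-1 by lia.
  have Dk : descent Q k = (Ordinal lt_k' \in S1) by rewrite -eq_S1 mem_Des.
  by have := key (Ordinal lt_k'); rewrite /= Dk eqxx => /andP[].
- by rewrite last_k // /gap; have := lambda_last ge_k; lia.
have lt_k' : k < n.-1 by lia.
have Dk : descent Q k = (Ordinal lt_k' \in S1) by rewrite -eq_S1 mem_Des.
by have := key (Ordinal lt_k'); rewrite /= Dk eqxx => /andP[].
Qed.

(** An increase of lambda needs [v] but not [u] in [S2] and no descent between them, which
    [descent_Neg] forbids. *)
Lemma lambda_sorted : Des Q = S1 -> Neg Q = S2 -> sorted geq la.
Proof.
move=> eq_S1 eq_S2; apply/(sortedP 0) => k; rewrite size_tuple => lt_k /=.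
have lt_k' : k < n.-1 by lia.
pose u := Ordinal (ltnW lt_k); pose v := Ordinal lt_k.
have := @lambda_gap (Ordinal lt_k') u v erefl erefl.
have := @descent_Neg k u v erefl erefl.
rewrite -(mem_Des (Ordinal lt_k')) eq_S1 eq_S2 /=.
by case: (v \in S2); case: (u \in S2); case: (_ \in S1) => // dN; try (have {}dN := dN isT); lia.
Qed.

End LambdaSS.

(** * Comparison of characters and multiplicities *)

Local Open Scope ring_scope.

(** Induction on the size of [D] with [la] free, as the recursion lowers [la]; the empty case is the
    Frobenius formula followed by standardization. *)
Lemma weight_sum_frobenius n (chi : bipartition n -> Iirr (B n)) (s : {perm 'I_n * bool}) :
  frobenius chi -> s \in B n -> forall (D : {set 'I_n}) (la : seq nat),
  size la = n -> sorted geq la ->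
  ratr (weight_sum s la D) = \sum_mu #|reduced_SYT (val mu) la D|%:R * 'chi_(chi mu) s.
Proof.
move=> frob sB D; have [m] := ubnP #|D|; elim: m D => // m IHm D.
rewrite ltnS => le_D la sz_la la_sort.
have [->|[k Dk]] := set_0Vmem D.
  (* No entry exceeds [sumn la], so taking [N' := sumn la] provides enough variables. *)
  have la_max : all (fun e => (e < 2 * (sumn la).+1)%N) la.
    apply/allP=> e e_la; rewrite mul2n -addnn ltn_addr // ltnS.
    by rewrite sumnE (big_rem e) //= leq_addr.
  have sz_la' : size la == n by apply/eqP.
  have -> : weight_sum s la set0 = \sum_(m <- monomials n la) (Bact s 'X_[m])@_m.
    by rewrite weight_sum0 -[la]/(tval (Tuple sz_la')) sum_Bact_monomials.
  rewrite (frobenius_monomials sB frob la_max la_sort); apply: eq_bigr => mu _.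
  congr (_%:R * _); rewrite card_semistandard_content //; apply: eq_card => Q; rewrite !inE.
  congr (_ && _); rewrite [X in _ && X](_ : _ = true) ?andbT //.
  by apply/forall_inP=> k; rewrite inE.
pose D' := D :\ k; have def_D : D = k |: D' by rewrite setD1K.
have nDk : k \notin D' by rewrite !inE eqxx.
have lt_D' : (#|D'| < m)%N by apply: leq_trans le_D; rewrite (cardsD1 k D) Dk.
have [lt_gap|ge_gap] := ltnP (nth 0%N la k) (nth 0%N la k.+1 + 2)%N.
  rewrite def_D weight_sum_gap // IHm //.
  by under [RHS]eq_bigr do rewrite reduced_SYT_gap //.
have ge2 : (2 <= nth 0%N la k)%N by lia.
rewrite -{1}(subkK la_sort ge2) def_D weight_sum_addk ?size_mkseq // subkK // rmorphB /=.
rewrite !IHm ?size_mkseq ?sorted_subk // -sumrB; apply: eq_bigr => mu _.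
by rewrite (card_reduced_SYT_subk _ sz_la la_sort nDk ge_gap) natrD mulrDl addrK.
Qed.

Lemma trace_RB_frobenius n (chi : bipartition n -> Iirr (B n)) (s : {perm 'I_n * bool})
    (S1 : {set 'I_n.-1}) (S2 : {set 'I_n}) :
  frobenius chi -> s \in B n -> ratr (\tr (RB (lambda_SS S1 S2) s)) =
  \sum_mu #|[set T in SYT mu | (Des T == S1) && (Neg T == S2)]|%:R * 'chi_(chi mu) s.
Proof.
move=> frob sB; rewrite trace_RB // -weight_sumT.
have [la_sort|la_nsort] := boolP (sorted geq (lambda_SS S1 S2)).
  rewrite (weight_sum_frobenius frob sB) ?size_tuple //; apply: eq_bigr => mu _.
  congr (_%:R * _); apply: eq_card => Q; rewrite !inE.
  case: (boolP (is_SYT Q)) => //= Q_SYT; rewrite -lambda_compatible //; congr (_ && _).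
  by apply: eq_forallb => k; rewrite inE.
(* For lambda not weakly decreasing, both sides vanish: no monomial sorts to it, and [lambda_sorted]
   excludes every tableau. *)
rewrite /weight_sum big_seq_cond big1 => [|m /andP[]]; last first.
  by rewrite mem_monomials => /eqP part_m; rewrite -part_m sorted_mpart in la_nsort.
rewrite rmorph0 big1 // => mu _; rewrite eq_card0 ?mul0r // => Q; rewrite !inE.
apply/negP=> /andP[Q_SYT /andP[/eqP eq_S1 /eqP eq_S2]].
by rewrite (lambda_sorted Q_SYT eq_S1 eq_S2) in la_nsort.
Qed.

Theorem theorem5p9 (n : nat) (chi : bipartition n -> Iirr (B n)) :
  frobenius chi ->
  forall (S1 : {set 'I_n.-1}) (S2 : {set 'I_n}) (mu : bipartition n),
    multiplicity (RB (lambda_SS S1 S2)) (chi mu)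
    = #|[set T in SYT mu | (Des T == S1) && (Neg T == S2)]|.
Proof.
move=> frob S1 S2 mu; have chi_inj := frobenius_inj frob.
pose rG := map_repr (ratr : {rmorphism rat -> algC}) (RB (lambda_SS S1 S2)).
pose N nu : nat := #|[set T in SYT nu | (Des T == S1) && (Neg T == S2)]|.
have char_rG : cfRepr rG = \sum_nu (N nu)%:R *: 'chi_(chi nu).
  apply/cfun_inP=> s sB; rewrite cfunE sB mulr1n map_reprE trace_map_mx.
  apply: etrans (trace_RB_frobenius S1 S2 frob sB) _; rewrite sum_cfunE; apply: eq_bigr => nu _.
  by rewrite cfunE.
(* Injectivity of [chi] ensures that only the term of [mu] contributes. *)
have coord : '[cfRepr rG, 'chi_(chi mu)] = (N mu)%:R.
  rewrite char_rG cfdot_suml (bigD1 mu) //= big1 => [|nu ne_nu].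
    by rewrite cfdotZl cfnorm_irr mulr1 addr0.
  by rewrite cfdotZl cfdot_irr (inj_eq chi_inj) (negPf ne_nu) mulr0.
apply/eqP; rewrite -eqC_nat -[X in _ == X]coord; apply/eqP.
rewrite (cfRepr_sim (mx_rsim_standard rG)) cfRepr_standard.
rewrite cfdot_suml (bigD1 (chi mu)) //= big1 => [|i ne_i].
  by rewrite cfdotZl cfnorm_irr mulr1 addr0.
by rewrite cfdotZl cfdot_irr (negPf ne_i) mulr0.
Qed.
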